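(* Let $J$ be a smooth almost complex structure on a neighborhood $\Omega$ of the origin in $\mathbb{C}^n$ with $J(0)=J_{st}$, and let $\Gamma\subset\Omega$ be a smooth real hypersurface through the origin with Levi form (with respect to $J$) vanishing identically at the points of $\Gamma$. Let $U$ be a sufficiently small neighborhood of the origin. Let $f:\mathbb{D}\to U$ be a $J$-holomorphic Bishop disc for $\Gamma$, that is, let $f$ be a $J$-holomorphic map continuous on $\overline{\mathbb{D}}$ such that $f(b\mathbb{D})\subset\Gamma$. Then $f(\overline{\mathbb{D}})$ lies in $\Gamma$.
   Context: $\mathbb{D}$ is the unit disc in $\mathbb{C}$, $b\mathbb{D}$ its boundary, $J_{st}$ the standard complex structure. A map $f:\mathbb{D}\to\Omega$ is $J$-holomorphic if $df\circ J_{st}=J\circ df$. $H_p^J(\Gamma)=T_p\Gamma\cap J(p)T_p\Gamma$. The Levi form of a $C^2$ real function $u$ at $p$ on a tangent vector $v$ is $L^J(u)(p)(v)=-d(J^*du)(X,JX)(p)$, where $X$ is any vector field with $X(p)=v$ and $J^*du=du\circ J$. With $r$ a defining function of $\Gamma$ in $\Omega$ ($\Gamma=\{r=0\}$, $dr\ne0$), the Levi form of $\Gamma$ vanishes identically if $L^J(r)(p)(v)=0$ for all $p\in\Gamma$, $v\in H_p^J(\Gamma)$. ''Sufficiently small'' means: there is a neighborhood $U_0$ of the origin, depending only on $(\Omega,J,\Gamma)$, such that the statement holds for every neighborhood $U\subset U_0$ of the origin. *)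

(* Defs.v *)
From HB Require Import structures.
From mathcomp Require Import all_boot all_order all_algebra.
From mathcomp Require Import all_classical all_reals all_analysis.
Set Implicit Arguments.
Unset Strict Implicit.
Unset Printing Implicit Defensive.
Import Order.TTheory GRing.Theory Num.Theory.
Import numFieldNormedType.Exports.
Local Open Scope classical_set_scope.
Local Open Scope ring_scope.

(* C^n is R^n x R^n: the row vector [row_mx x y] stands for x + iy.           *)
(* Endomorphisms act on row vectors on the right: J(p)v is [v *m J p].        *)
Notation Cn R n := 'rV[R]_(n + n).

Section Smoothness.
Context {R : realType} {V W : normedModType R}.

(* For an open set D of a finite-dimensional V this is the usual class C^k. *)
Fixpoint Ck (k : nat) (D : set V) (f : V -> W) : Prop :=
  if k is k'.+1 then
    (forall x, D x -> differentiable f x) /\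
    (forall v, Ck k' D (fun x => 'd f x v))
  else forall x, D x -> {for x, continuous f}.

Definition smooth_on (D : set V) (f : V -> W) : Prop := forall k, Ck k D f.

End Smoothness.

Section AlmostComplex.
Context {R : realType} {n : nat}.
Local Notation E := (Cn R n).

Definition Jst : 'M[R]_(n + n) := block_mx 0 1%:M (- 1%:M) 0.

Lemma Jst_mul_i (x y : 'rV[R]_n) : row_mx x y *m Jst = row_mx (- y) x.
Proof.
by rewrite mul_row_block !mulmx0 mulmxN !mulmx1 add0r addr0.
Qed.

Definition almost_complex (Omega : set E) (J : E -> 'M[R]_(n + n)) : Prop :=
  smooth_on Omega J /\ forall p, Omega p -> J p *m J p = - 1%:M.

(* 1-forms are functions of the point and of the vector. The value at (v, w)  *)
(* of the exterior derivative is computed by extending v and w to constant    *)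
(* vector fields, whose Lie bracket is 0.                                     *)
Definition dform (a : E -> E -> R) (p v w : E) : R :=
  'd (fun x => a x w : R^o) p v - 'd (fun x => a x v : R^o) p w.

Definition Jstar_d (J : E -> 'M[R]_(n + n)) (u : E -> R) (p v : E) : R :=
  'd (u : E -> R^o) p (v *m J p).

(* d(J^* du) is a tensor, so -d(J^* du)(X, JX)(p) depends only on v = X(p). *)
Definition levi_form (J : E -> 'M[R]_(n + n)) (u : E -> R) (p v : E) : R :=
  - dform (Jstar_d J u) p v (v *m J p).

Definition defining_function (Omega Gamma : set E) (r : E -> R) : Prop :=
  [/\ smooth_on Omega (r : E -> R^o),
      Gamma = Omega `&` [set p | r p = 0] &
      forall p, Gamma p -> exists v, 'd (r : E -> R^o) p v != 0].

Definition smooth_hypersurface (Omega Gamma : set E) : Prop :=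
  exists r, defining_function Omega Gamma r.

Definition tangent_space (r : E -> R) (p : E) : set E :=
  [set v | 'd (r : E -> R^o) p v = 0].

Definition complex_tangent_space (J : E -> 'M[R]_(n + n)) (r : E -> R)
    (p : E) : set E :=
  tangent_space r p `&` (fun v => v *m J p) @` tangent_space r p.

Definition levi_flat (Omega : set E) (J : E -> 'M[R]_(n + n))
    (Gamma : set E) : Prop :=
  exists2 r, defining_function Omega Gamma r &
    forall p v, Gamma p -> complex_tangent_space J r p v ->
      levi_form J r p v = 0.

End AlmostComplex.

Section Discs.
Context {R : realType}.

(* The norm of row vectors is the sup norm, hence the explicit squares. *)
Definition udisc : set (Cn R 1) := [set z | \sum_i z 0 i ^+ 2 < 1].
Definition udisc_closed : set (Cn R 1) := [set z | \sum_i z 0 i ^+ 2 <= 1].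
Definition udisc_boundary : set (Cn R 1) := [set z | \sum_i z 0 i ^+ 2 = 1].

(* Maps of the disc are restrictions of total functions. *)
Definition J_holomorphic {n : nat} (J : Cn R n -> 'M[R]_(n + n))
    (f : Cn R 1 -> Cn R n) : Prop :=
  Ck 1 udisc f /\
  forall z v, udisc z -> 'd f z (v *m Jst) = 'd f z v *m J (f z).

Definition bishop_disc {n : nat} (J : Cn R n -> 'M[R]_(n + n))
    (Gamma : set (Cn R n)) (f : Cn R 1 -> Cn R n) : Prop :=
  [/\ J_holomorphic J f,
      {within udisc_closed, continuous f} &
      f @` udisc_boundary `<=` Gamma].

End Discs.

(* Main.v *)
Require Import Defs.
From HB Require Import structures.
From mathcomp Require Import all_boot all_order all_algebra.
From mathcomp Require Import all_classical all_reals all_analysis.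
From mathcomp Require Import ring lra.
Import Order.TTheory GRing.Theory Num.Theory.
Import numFieldNormedType.Exports.
Local Open Scope classical_set_scope.
Local Open Scope ring_scope.
Set Implicit Arguments.
Unset Strict Implicit.
Unset Printing Implicit Defensive.

(** Why a small Bishop disc of a Levi-flat hypersurface stays inside it.

    Let r be a defining function, f the disc and phi = r o f, which vanishes on
    the circle. For a J-holomorphic f the Laplacian of phi at z is the Levi
    form of r at f(z) on v = df(d/dx). That form vanishes at the points of
    Gamma on the complex tangent vectors. Moving a point near 0 to Gamma costs
    O(|r|) and moving a vector to the complex tangent space costs
    O(|dr(v)| + |dr(Jv)|), hence ([levi_flat_bound])
      |L(r)(p)(v)| <= C (|r(p)| |v|^2 + |v| (|dr(v)| + |dr(Jv)|)).
    As dr(v) and dr(Jv) are the partial derivatives of phi, this reads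
      |Lap phi| <= C (|df|^2 |phi| + |df| |grad phi|).
    The coefficients may blow up at the circle, but only like |df|, and that is
    absorbed by the function |p|^2, which is strictly plurisubharmonic near 0
    for any J ([levi_sqnorm_ge]): on a small ball, w = 1 - K |f|^2 is a
    positive supersolution of the linear inequality.

    So, if phi were positive somewhere, take m = max (phi + eps |z|^2) / w. With
    eps small, it is attained in the open disc, at a point where
    (r + m K |p|^2 - m) o f + eps |z|^2 has a local maximum. The first order
    condition bounds grad phi by m K |f| |df| + O(eps), and then the Laplacian
    is positive there, a contradiction ([bishop_disc_one_sided]); the term
    eps |z|^2 takes care of the critical points of f. The same applied to - r
    gives phi = 0.

    A J-holomorphic map is only assumed to be of class C^1, so phi has no
    classical Laplacian. What remains is that the 1-form f^*(J^* dr) is, up to sign,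
    the conjugate differential of phi and, at any given point z, differs from an
    exact form by a form vanishing at z whose coefficients are differentiable at
    z. Averaging over small circles around z turns this into a maximum principle
    ([weak_laplacian_no_max], [levi_max_principle]), without any elliptic
    regularity. *)

(** * Differential calculus *)

Lemma nbhs_shift (R : realType) (V : normedModType R) (x : V) (P : set V) :
  nbhs x P -> exists2 d : R, 0 < d & forall h, `|h| < d -> P (x + h).
Proof.
move=> /nbhs_normP[d /= d0 dP]; exists d => // h hd; apply: dP => /=.
by rewrite opprD addNKr normrN.
Qed.

Lemma diff_expand (R : realType) (V W : normedModType R) (f : V -> W) (x : V) :
  differentiable f x -> forall eta : R, 0 < eta ->
  exists2 d : R, 0 < d &
    forall h, `|h| < d -> `|f (x + h) - f x - 'd f x h| <= eta * `|h|.
Proof.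
move=> /diff_locallyP[_ /eqaddoP H] eta eta0.
have /nbhs_shift[d d0 dP] := H _ eta0; exists d => // h /dP.
rewrite add0r /= !fctE /= [h + x]addrC.
by rewrite opprD addrA.
Qed.

(** Converse of [diff_expand]; the way in which differentials are computed below
    when the usual rules do not apply. *)
Lemma diff_of_expand (R : realType) (V W : normedModType R) (f : V -> W) (x : V)
    (l : {linear V -> W}) :
  continuous l ->
  (forall eta : R, 0 < eta -> exists2 d : R, 0 < d &
    forall h, `|h| < d -> `|f (x + h) - f x - l h| <= eta * `|h|) ->
  differentiable f x /\ 'd f x = l :> (V -> W).
Proof.
move=> cl H.
have E : f \o shift x = cst (f x) + l +o_ 0 id.
  apply/eqaddoP => eta eta0; have [d d0 dP] := H _ eta0.
  apply/nbhs_normP; exists d => // h /=; rewrite sub0r normrN => hd.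
  by rewrite !fctE /= [h + x]addrC opprD addrA; exact: dP.
have dE := diff_unique cl E.
by split => //; apply/diff_locallyP; rewrite dE.
Qed.

Lemma is_derive_comp_diff (R : realType) (V W : normedModType R) (f : V -> W)
    (g : R -> V) (g' : V) (t : R) :
  is_derive t 1 g g' -> differentiable f (g t) ->
  is_derive t 1 (fun t => f (g t)) ('d f (g t) g').
Proof.
move=> [dg gE] df; have dg1 := dg; move/derivable1_diffP in dg1.
have dfg : differentiable (f \o g) t by apply: differentiable_comp.
apply: DeriveDef; first exact/derivable1_diffP.
by rewrite deriveE // diff_comp //= -gE deriveE.
Qed.

Lemma is_derive_scalel (R : realType) (V : normedModType R) (k : R -> R)
    (k' t : R) (w : V) :
  is_derive t 1 k k' -> is_derive t 1 (fun t => k t *: w) (k' *: w).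
Proof.
move=> [dk kE]; have dk1 := dk; move/derivable1_diffP in dk1.
apply: DeriveDef; first exact/derivable1_diffP/differentiableZl.
by rewrite deriveE ?diffZl -?kE ?deriveE //; exact: differentiableZl.
Qed.

Section PointwiseDifferentials.
Context {R : realType} {U V W : normedModType R}.

Lemma diffD_at (f g : V -> W) x v : differentiable f x -> differentiable g x ->
  'd (fun y => f y + g y) x v = 'd f x v + 'd g x v.
Proof. by move=> df /(diffD df) /(congr1 (fun h : V -> W => h v)). Qed.

Lemma diffB_at (f g : V -> W) x v : differentiable f x -> differentiable g x ->
  'd (fun y => f y - g y) x v = 'd f x v - 'd g x v.
Proof. by move=> df /(diffB df) /(congr1 (fun h : V -> W => h v)). Qed.

Lemma diffM_at (f g : V -> R^o) x v :
  differentiable f x -> differentiable g x ->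
  'd (fun y => f y * g y : R^o) x v = f x * 'd g x v + g x * 'd f x v.
Proof. by move=> df /(diffM df) /(congr1 (fun h : V -> R => h v)). Qed.

Lemma diff_comp_at (f : U -> V) (g : V -> W) x v :
  differentiable f x -> differentiable g (f x) ->
  'd (fun y => g (f y)) x v = 'd g (f x) ('d f x v).
Proof. by move=> df /(diff_comp df) /(congr1 (fun h : U -> W => h v)). Qed.

Lemma diffB_cst_at (f : V -> W) c x v : differentiable f x ->
  differentiable (fun y => f y - c) x /\ 'd (fun y => f y - c) x v = 'd f x v.
Proof.
move=> df; have dc := differentiable_cst c x; split.
  exact: (differentiableB df dc).
have dc0 : 'd (cst c) x v = 0 by rewrite diff_cst.
by apply: etrans (diffB_at v df dc) _; rewrite [X in _ - X]dc0 subr0.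
Qed.

Lemma diffZ_at (f : V -> R^o) (c : R) x v :
  differentiable f x -> 'd (fun y => c * f y : R^o) x v = c * 'd f x v.
Proof. by move=> /(diffZ c) /(congr1 (fun h : V -> R => h v)). Qed.

End PointwiseDifferentials.

Lemma diff_eq_on (R : realType) (V W : normedModType R) (D : set V)
    (f g : V -> W) (x : V) :
  open D -> D x -> (forall y, D y -> f y = g y) -> differentiable f x ->
  differentiable g x /\ forall v, 'd g x v = 'd f x v.
Proof.
move=> oD Dx fg df.
have [d d0 dP] := nbhs_shift (open_nbhs_nbhs (conj oD Dx)).
have [dg gE] : differentiable g x /\ 'd g x = 'd f x :> (V -> W).
  apply: diff_of_expand; first by move: df => /diff_continuous.
  move=> eta eta0; have [d' d'0 d'P] := diff_expand df eta0.
  exists (Num.min d d'); first by rewrite lt_min d0.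
  by move=> h; rewrite lt_min => /andP[/dP Dh /d'P]; rewrite !fg.
by split=> // v; rewrite gE.
Qed.

Lemma diff_local_max (R : realType) (V : normedModType R) (u : V -> R^o) z v :
  differentiable u z -> (\forall x \near z, u x <= u z) -> 'd u z v = 0.
Proof.
move=> du zmax.
suff le0 w : 'd u z w <= 0.
  by apply/eqP; rewrite eq_le le0 -oppr_le0 -linearN le0.
rewrite leNgt; apply/negP => w0.
have e0 : 0 < 'd u z w / (2 * (`|w| + 1)).
  by rewrite divr_gt0 // mulr_gt0 // ltr_pwDr.
have [d1 d10 H1] := diff_expand du e0.
have [d2 d20 H2] := nbhs_shift zmax.
pose t := Num.min d1 d2 / (2 * (`|w| + 1)).
have w1 : 0 < `|w| + 1 by rewrite ltr_pwDr.
have t0 : 0 < t by rewrite divr_gt0 ?lt_min ?d10 // mulr_gt0.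
have tw : `|t *: w| < Num.min d1 d2.
  rewrite normrZ gtr0_norm // /t mulrAC ltr_pdivrMr ?mulr_gt0 //.
  rewrite ltr_pM2l ?lt_min ?d10 //.
  by move: w1 (normr_ge0 w); clear; lra.
move: (tw); rewrite lt_min => /andP[/H1 h1 /H2 h2].
have E : 'd u z (t *: w) = t * 'd u z w by exact: linearZ.
rewrite E normrZ (gtr0_norm t0) in h1.
have h3 : 'd u z w / (2 * (`|w| + 1)) * (t * `|w|) <= t * 'd u z w / 2.
  rewrite (_ : _ * (t * _) = t * 'd u z w / 2 * (`|w| / (`|w| + 1))); last first.
    by field; rewrite gt_eqF.
  rewrite ler_piMr //; first by rewrite divr_ge0 // mulr_ge0 // ltW.
  by rewrite ler_pdivrMr // mul1r lerDl.
have h4 : 0 < t * 'd u z w by exact: mulr_gt0.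
have := le_trans h1 h3; rewrite ler_norml => /andP[h5 _].
by move: h2 h4 h5; clear; move: (u _) (u z) (t * _) => x y D; lra.
Qed.

(** A factor that is differentiable and vanishes at z makes up for the mere
    continuity of the other one: K w = w(z) K + K (w - w(z)), where the last term
    is o(h) because K = O(h). This is how the products of second and first
    derivatives of a C^1 disc are differentiated. *)
Lemma diff_vanishing_mul (R : realType) (V : normedModType R) (K w : V -> R^o)
    (z : V) :
  differentiable K z -> K z = 0 -> {for z, continuous w} ->
  differentiable (fun x => K x * w x : R^o) z /\
  forall h, 'd (fun x => K x * w x : R^o) z h = w z * 'd K z h.
Proof.
move=> dK K0 cw.
have dwK : differentiable (w z *: K) z by exact: differentiableZ.
have dwKE h : 'd (w z *: K) z h = w z * 'd K z h.
  exact: (congr1 (fun g : V -> R => g h) (diffZ (w z) dK)).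
have [M M0 MP] := linear_lipschitz (diff_continuous dK).
have [dd dE] : differentiable (fun x => K x * w x : R^o) z /\
    'd (fun x => K x * w x : R^o) z = 'd (w z *: K) z :> (V -> R^o).
  apply: diff_of_expand; first exact: diff_continuous.
  move=> eta eta0.
  pose a := eta / (2 * (M + 1)); pose b := eta / (2 * (`|w z| + 1)).
  have wz0 : 0 < `|w z| + 1 by rewrite ltr_pwDr.
  have a0 : 0 < a by rewrite divr_gt0 // mulr_gt0 // addr_gt0.
  have b0 : 0 < b by rewrite divr_gt0 // mulr_gt0.
  have [d1 d10 d1P] := diff_expand dK b0.
  have [d2 d20 d2P] := diff_expand dK ltr01.
  have : (\forall x \near z, `|w z - w x| < a).
    have cw' : w x @[x --> z] --> w z := cw.
    exact: (cvgr_dist_lt _ _ cw' _ a0).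
  move=> /nbhs_shift[d3 d30 d3P].
  exists (Num.min (Num.min d1 d2) d3); first by rewrite !lt_min d10 d20.
  move=> h; rewrite !lt_min => /andP[/andP[/d1P h1 /d2P h2] /d3P h3].
  rewrite K0 mul0r subr0 dwKE; rewrite K0 !subr0 in h1 h2.
  have h4 : `|K (z + h)| <= (M + 1) * `|h|.
    rewrite -[K _](subrK ('d K z h)) (le_trans (ler_normD _ _)) //.
    by rewrite [M + 1]addrC mulrDl lerD.
  rewrite (_ : K (z + h) * w (z + h) - _ = w z * (K (z + h) - 'd K z h)
    - K (z + h) * (w z - w (z + h))); last by ring.
  apply: le_trans (ler_normB _ _) _; rewrite !normrM.
  rewrite [leRHS](_ : _ = (`|w z| + 1) * (b * `|h|) + (M + 1) * `|h| * a).
    apply: lerD; last by apply: ler_pM => //; exact: ltW.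
    by apply: ler_pM => //; rewrite lerDl.
  by rewrite /a /b; field; rewrite !gt_eqF // addr_gt0.
by split=> // h; rewrite dE dwKE.
Qed.

Lemma diff_sum_vanishing_mul (R : realType) (V : normedModType R) m
    (K w : 'I_m -> V -> R^o) (z : V) :
  (forall j, differentiable (K j) z) -> (forall j, K j z = 0) ->
  (forall j, {for z, continuous (w j)}) ->
  differentiable (fun x => \sum_j K j x * w j x : R^o) z /\
  forall h, 'd (fun x => \sum_j K j x * w j x : R^o) z h =
    \sum_j w j z * 'd (K j) z h.
Proof.
move=> dK K0 cw; pose Kw j x : R^o := K j x * w j x.
have H j := diff_vanishing_mul (dK j) (K0 j) (cw j).
have E : (fun x => \sum_j K j x * w j x : R^o) = \sum_j Kw j.
  by apply/funext => x; rewrite fct_sumE.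
have dKw : differentiable (\sum_j Kw j) z.
  by apply: differentiable_sum => j; have [] := H j.
rewrite E; split=> // h; rewrite -deriveE // derive_sum => [|j].
  by apply: eq_bigr => j _; have [d <-] := H j; rewrite deriveE.
by apply: diff_derivable; have [] := H j.
Qed.

(** * A maximum principle for a weak Laplacian in the plane *)

(** If the mean of V(rho, .) over [0, T] has a positive derivative in rho, then
    V(rho, .) cannot stay below V(0, .). Positivity is witnessed by a minorant f
    of the derivative V' with a primitive F increasing from 0 to T; as only F
    enters, the exact part of the derivative does not have to be integrated. *)
Lemma increasing_mean_exceeds (R : realType) (V V' : R -> R -> R) (r0 T C : R) :
  0 < r0 -> 0 < T ->
  (forall rho t : R, `|rho| < r0 -> is_derive rho 1 (V ^~ t) (V' rho t)) ->
  (forall rho : R, `|rho| < r0 -> continuous (V rho : R -> R^o)) ->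
  (forall rho : R, `|rho| < r0 -> continuous (V' rho : R -> R^o)) ->
  (forall rho t : R, `|rho| < r0 -> `|V' rho t| <= C) ->
  (forall rho : R, 0 < rho < r0 -> exists F f : R -> R,
     [/\ forall t : R, is_derive t 1 F (f t), continuous (f : R -> R^o),
         forall t, f t <= V' rho t & F 0 < F T]) ->
  exists rho t : R, 0 < rho < r0 /\ V 0 t < V rho t.
Proof.
move=> r0_gt0 T_gt0 dV cV cV' ubV' incr.
pose mu : {measure set _ -> \bar R} := @lebesgue_measure R.
pose B : set R := `[0, T]%classic.
have mB : measurable B by exact: measurable_itv.
have cB : compact B by exact: segment_compact.
have cint (g : R -> R) : continuous (g : R -> R^o) ->
    mu.-integrable B (EFin \o g).
  move=> cg; apply: continuous_compact_integrable => //.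
  exact: continuous_subspaceT.
have itvE (rho : R) : (rho \in `](- r0), r0[%R) = (`|rho| < r0).
  by rewrite in_itv /= ltr_norml.
have itvP (rho : R) : (`](- r0), r0[)%classic rho = (`|rho| < r0) :> Prop.
  by rewrite -itvE.
pose m rho : R := (\int[mu]_(t in B) V rho t)%R.
have d1 rho t : `|rho| < r0 -> partial1of2 V rho t = V' rho t.
  by move=> h; rewrite partial1of2E; have [_ ->] := dV _ t h.
have dm (rho : R) : `|rho| < r0 ->
    is_derive rho 1 m (\int[mu]_(t in B) V' rho t)%R.
  move=> h.
  have Irho : (`](- r0), r0[)%classic rho by rewrite itvP.
  have intV x : (`](- r0), r0[)%classic x -> mu.-integrable B (EFin \o V x).
    by rewrite itvP => hx; exact/cint/cV.
  have derV (x y : R) : (`](- r0), r0[)%classic x -> B y -> derivable (V ^~ y) x 1.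
    by rewrite itvP => hx _; have [] := dV _ y hx.
  have C0 : forall y : R, 0 <= C.
    by move=> y; apply: le_trans (ubV' rho 0 h).
  have intC : mu.-integrable B (EFin \o (fun=> C)).
    by apply: cint => x; exact: cvg_cst.
  have ub x y : (`](- r0), r0[)%classic x -> B y -> `|partial1of2 V x y| <= C.
    by rewrite itvP => hx _; rewrite d1// ubV'.
  apply: DeriveDef.
    exact: (@derivable_under_integral R _ _ mu V B mB rho _ _ Irho intV derV
      (fun=> C) C0 intC ub).
  rewrite -derive1E.
  rewrite (@differentiation_under_integral R _ _ mu V B mB rho _ _ Irho intV derV
    (fun=> C) C0 intC ub).
  by apply: eq_Rintegral => t _; rewrite d1.
have dm_gt0 rho : 0 < rho < r0 -> 0 < (\int[mu]_(t in B) V' rho t)%R.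
  move=> h; have [F [f [dF cf fV' FT]]] := incr _ h.
  have hn : `|rho| < r0 by case/andP: h => ? ?; rewrite gtr0_norm.
  apply: (@lt_le_trans _ _ (\int[mu]_(t in B) f t)%R); last first.
    apply: le_Rintegral => //; first exact: cint.
    exact/cint/cV'.
  rewrite /Rintegral (@continuous_FTC2 R f F) //.
  - by rewrite -EFinB /= subr_gt0.
  - exact: continuous_subspaceT.
  - have cF : continuous (F : R -> R^o).
      move=> x; apply/differentiable_continuous/derivable1_diffP.
      by have [] := dF x.
    by split=> [x _||]; [have [] := dF x|exact: cvg_at_right_filter (cF _)
                        |exact: cvg_at_left_filter (cF _)].
  - by move=> x _; rewrite derive1E; have [_ ->] := dF x.
apply: contrapT => noinc.
have Vle rho t : 0 < rho < r0 -> V rho t <= V 0 t.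
  move=> h; rewrite leNgt; apply/negP => lt.
  by apply: noinc; exists rho, t.
have h2 : 0 < r0 / 2 < r0 by lra.
have dm' (x : R) : x \in `]0, (r0 / 2)[%R ->
    is_derive x 1 m (\int[mu]_(t in B) V' x t)%R.
  by rewrite in_itv /= => xx; apply: dm; rewrite ger0_norm; lra.
have cm : {within `[0, (r0 / 2)], continuous (m : R -> R^o)}.
  apply: derivable_within_continuous => x; rewrite in_itv /= => xx.
  by have [] := dm x => //; rewrite ger0_norm; lra.
have [c] := MVT (proj1 (andP h2)) dm' cm.
rewrite in_itv /= => cc E.
have : m (r0 / 2) <= m 0.
  apply: le_Rintegral => //.
  + by apply/cint/cV; rewrite ger0_norm; lra.
  + by apply/cint/cV; rewrite normr0.
  + by move=> x _; exact: Vle.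
rewrite -subr_le0 E leNgt mulr_gt0 //; last by lra.
by apply: dm_gt0; lra.
Qed.

Lemma is_derive_circle (R : realType) (V : normedModType R) (z e1 e2 : V)
    (rho t : R) :
  is_derive t 1 (fun t => z + rho *: (cos t *: e1 + sin t *: e2))
    (rho *: (- sin t *: e1 + cos t *: e2)).
Proof.
have h1 := is_derive_scalel e1 (is_derive_cos t).
have h2 := is_derive_scalel e2 (is_derive_sin t).
by apply: is_derive_eq; rewrite add0r.
Qed.

Lemma is_derive_ray (R : realType) (V : normedModType R) (z w : V) (rho : R) :
  is_derive rho 1 (fun rho => z + rho *: w) w.
Proof.
have h := is_derive_scalel w (is_derive_id rho (1 : R)).
by apply: is_derive_eq; rewrite add0r scale1r.
Qed.

Lemma norm_circle (R : realType) (V : normedModType R) (e1 e2 : V) (t : R) :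
  `|cos t *: e1 + sin t *: e2| <= `|e1| + `|e2|.
Proof.
apply: (le_trans (ler_normD _ _)); rewrite !normrZ; apply: lerD.
  by rewrite ler_piMl // cos_max.
by rewrite ler_piMl // sin_max.
Qed.

(** The pointwise inequality behind [weak_laplacian_no_max], at a point of the
    circle of radius rho with cosine x and sine y: (u1, u2) and (s1, s2) are the
    gradients of u and s, (k1, k2) are the values of c1 and c2 at the centre, and
    a, b, b', c are the entries of their Jacobian. *)
Lemma circle_flux_bound (R : realType) (x y u1 u2 s1 s2 k1 k2 a b b' c rho : R) :
  x ^+ 2 + y ^+ 2 = 1 -> `|x| <= 1 -> `|y| <= 1 ->
  `|u1 + s2 - (k1 + rho * (x * a + y * b))| <= rho * ((a + c) / 8) ->
  `|u2 - s1 - (k2 + rho * (x * b' + y * c))| <= rho * ((a + c) / 8) ->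
  k1 * x + k2 * y
    + rho * ((a + c) / 4 + (a - c) / 2 * (x * x - y * y) + (b + b') * (y * x))
    - (- y * s1 + x * s2) <= x * u1 + y * u2.
Proof.
have wlow (w p q e : R) : `|w| <= 1 -> `|p - q| <= e -> w * q - e <= w * p.
  move=> w1 pq; rewrite lerBlDr -lerBlDl -mulrBr.
  apply: le_trans (ler_norm _) _.
  by rewrite normrM; apply: le_trans pq; rewrite distrC ler_piMl.
move=> xy x1 y1 /(wlow _ _ _ _ x1) I1 /(wlow _ _ _ _ y1) I2.
rewrite -subr_ge0; set G := (X in 0 <= X).
have -> : G = (y * (u2 - s1) - (y * (k2 + rho * (x * b' + y * c))
   - rho * ((a + c) / 8)))
  + (x * (u1 + s2) - (x * (k1 + rho * (x * a + y * b))
   - rho * ((a + c) / 8))) + rho * (a + c) / 2 * (x ^+ 2 + y ^+ 2 - 1).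
  by rewrite /G; field.
by rewrite xy subrr mulr0 addr0 addr_ge0 // subr_ge0.
Qed.

(** In the coordinates given by e1 and e2, the equations say that the conjugate
    differential of u is c1 dy - c2 dx - ds, so that 'd c1 z e1 + 'd c2 z e2
    is the Laplacian of u at z in a weak sense; u itself is only C^1. The derivative
    in rho of the mean of u over the circle of radius rho around z is the mean flux
    of grad u. The part ds integrates to zero over the circle and, to first order
    in rho, the rest gives rho / 2 times this Laplacian. Thus the means increase
    and u exceeds u(z). *)
Lemma weak_laplacian_no_max (R : realType) (V : normedModType R) (z e1 e2 : V)
    (D : set V) (u s c1 c2 : V -> R^o) :
  nbhs z D -> Ck 1 D u -> Ck 1 D s ->
  (forall x, D x -> 'd u x e1 + 'd s x e2 = c1 x) ->
  (forall x, D x -> 'd u x e2 - 'd s x e1 = c2 x) ->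
  differentiable c1 z -> differentiable c2 z ->
  0 < 'd c1 z e1 + 'd c2 z e2 ->
  (\forall x \near z, u x <= u z) -> False.
Proof.
move=> nD [du cu] [ds cs] c1E c2E dc1 dc2.
set S := _ + _ => S0 umax.
pose N : R := `|e1| + `|e2| + 1.
have N0 : 0 < N by rewrite /N; have := normr_ge0 e1; have := normr_ge0 e2; lra.
pose P (t : R) : V := cos t *: e1 + sin t *: e2.
pose Q (t : R) : V := - sin t *: e1 + cos t *: e2.
pose g (rho t : R) : V := z + rho *: P t.
have PN rho t : `|rho *: P t| <= `|rho| * N.
  rewrite normrZ ler_wpM2l //; apply: (le_trans (norm_circle _ _ _)).
  by rewrite /N lerDl.
(* First order expansions of c1 and c2 with this error cost at most half of the
   gain rho S pi of the flux. *)
pose eta : R := S / (8 * N).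
have eta0 : 0 < eta by rewrite divr_gt0 // mulr_gt0.
have [d1 d1_gt0 d1P] := diff_expand dc1 eta0.
have [d2 d2_gt0 d2P] := diff_expand dc2 eta0.
have [d3 d3_gt0 d3P] := nbhs_shift nD.
have [d4 d4_gt0 d4P] := nbhs_shift umax.
have Dz : D z by exact: nbhs_singleton.
have cD (e : V) : (\forall x \near z, `|'d u x e| < `|'d u z e| + 1).
  have h : ('d u x e : R^o) @[x --> z] --> ('d u z e : R^o) := cu e z Dz.
  by apply: (cvgr_norm_lt _ h); rewrite ltrDl.
have [d5 d5_gt0 d5P] := nbhs_shift (cD e1).
have [d6 d6_gt0 d6P] := nbhs_shift (cD e2).
pose d := Num.min (Num.min (Num.min d1 d2) (Num.min d3 d4)) (Num.min d5 d6).
have d_gt0 : 0 < d by rewrite !lt_min; lra.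
have dlt x : x < d -> [/\ x < d1, x < d2, x < d3, x < d4 & x < d5 /\ x < d6].
  by rewrite !lt_min => /andP[/andP[/andP[-> ->] /andP[-> ->]] /andP[-> ->]].
pose r0 := d / N.
have r0_gt0 : 0 < r0 by rewrite divr_gt0.
have small rho t : `|rho| < r0 -> `|rho *: P t| < d.
  by rewrite /r0 ltr_pdivlMr // => h; exact: le_lt_trans (PN _ _) h.
have gD rho t : `|rho| < r0 -> D (g rho t).
  by move=> /(small _ t)/dlt[_ _ /d3P].
have cg rho : continuous (g rho).
  move=> t; apply/differentiable_continuous/derivable1_diffP.
  by have [] := is_derive_circle z e1 e2 rho t.
have cug (w : V -> R^o) rho (e : V) : (forall x, D x -> {for x, continuous w}) ->
    `|rho| < r0 -> continuous (fun t => w (g rho t)).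
  move=> cw h t; apply: (@continuous_comp _ _ _ (g rho) w); first exact: cg.
  exact/cw/gD.
have diffE (f : V -> R^o) x a b : 'd f x (a *: e1 + b *: e2) =
    a * 'd f x e1 + b * 'd f x e2.
  by rewrite linearD !linearZ.
have ccos : continuous (@cos R : R -> R^o) by exact: continuous_cos.
have csin : continuous (@sin R : R -> R^o) by exact: continuous_sin.
have : exists rho t : R, 0 < rho < r0 /\ u (g 0 t) < u (g rho t).
  apply: (@increasing_mean_exceeds R (fun rho t => u (g rho t))
    (fun rho t => 'd u (g rho t) (P t)) r0 (pi *+ 2)
    (`|'d u z e1| + 1 + (`|'d u z e2| + 1))) => //.
  - by rewrite mulrn_wgt0 // pi_gt0.
  - move=> rho t h.
    exact: (@is_derive_comp_diff _ _ _ u (fun rho => g rho t) (P t) rho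
      (is_derive_ray _ _ _) (du _ (gD _ _ h))).
  - move=> rho h; apply: (cug u) => // x Dx.
    exact/differentiable_continuous/du.
  - move=> rho h t.
    rewrite (_ : (fun t => _) = (fun t => cos t * 'd u (g rho t) e1
       + sin t * 'd u (g rho t) e2 : R^o)); last first.
      by apply/funext => t'; rewrite diffE.
    apply: cvgD; apply: cvgM; first exact: ccos.
    + apply: (cug (fun x => 'd u x e1)) => //; exact: cu.
    + exact: csin.
    + apply: (cug (fun x => 'd u x e2)) => //; exact: cu.
  - move=> rho t h; rewrite diffE; apply: (le_trans (ler_normD _ _)).
    have [_ _ _ _ [h5 h6]] := dlt _ (small _ t h).
    rewrite !normrM; apply: lerD.
      apply: (@le_trans _ _ (1 * `|'d u (g rho t) e1|)).
        by rewrite ler_wpM2r // cos_max.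
      by rewrite mul1r; exact/ltW/d5P.
    apply: (@le_trans _ _ (1 * `|'d u (g rho t) e2|)).
      by rewrite ler_wpM2r // sin_max.
    by rewrite mul1r; exact/ltW/d6P.
  move=> rho /andP[rho0 rhor].
  have h : `|rho| < r0 by rewrite gtr0_norm.
  pose a := 'd c1 z e1; pose b := 'd c1 z e2 + 'd c2 z e1; pose c := 'd c2 z e2.
  (* The primitive in t of the lower bound of the flux; s / rho is its exact
     part, and S / 4 instead of S / 2 leaves room for the errors. *)
  pose F t := c1 z * sin t - c2 z * cos t
    + rho * (S / 4 * t + (a - c) / 2 * (sin t * cos t) + b / 2 * (sin t * sin t))
    - s (g rho t) / rho.
  pose f t := c1 z * cos t + c2 z * sin t
    + rho * (S / 4 + (a - c) / 2 * (cos t * cos t - sin t * sin t)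
             + b * (sin t * cos t))
    - 'd s (g rho t) (Q t).
  exists F, f; split.
  - move=> t.
    have dsg := @is_derive_comp_diff _ _ _ s (g rho) _ t
      (is_derive_circle z e1 e2 rho t) (ds _ (gD _ _ h)).
    have e : 'd s (g rho t) (rho *: Q t) = rho * 'd s (g rho t) (Q t).
      exact: linearZ.
    rewrite -/(Q t) e in dsg.
    rewrite /F; apply: is_derive_eq.
    by rewrite /f /GRing.scale /=; field; rewrite gt_eqF.
  - have cM (p q : R -> R^o) : continuous p -> continuous q ->
        continuous (fun t => p t * q t : R^o).
      by move=> cp cq t; apply: cvgM; [exact: cp | exact: cq].
    have cA (p q : R -> R^o) : continuous p -> continuous q ->
        continuous (fun t => p t + q t : R^o).
      by move=> cp cq t; apply: cvgD; [exact: cp | exact: cq].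
    have cN (p : R -> R^o) : continuous p -> continuous (fun t => - p t : R^o).
      by move=> cp t; apply: cvgN; exact: cp.
    have cC (k : R) : continuous (fun _ : R => (k : R^o)) by exact: cst_continuous.
    have cds e : continuous (fun t => 'd s (g rho t) e).
      by apply: (cug (fun x => 'd s x e)) => //; exact: cs.
    have cdsQ : continuous (fun t => 'd s (g rho t) (Q t)).
      rewrite (_ : (fun t => _) = (fun t => - sin t * 'd s (g rho t) e1
         + cos t * 'd s (g rho t) e2)); last by apply/funext => t; rewrite diffE.
      exact: cA _ _ (cM _ _ (cN _ csin) (cds _)) (cM _ _ ccos (cds _)).
    apply: (cA _ _ (cA _ _ (cA _ _ _ _) _) (cN _ cdsQ)).
    + exact: cM.
    + exact: cM.
    + apply: (cM _ _ (cC _)); apply: (cA _ _ (cA _ _ _ _)).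
      * exact: cC.
      * apply: (cM _ _ (cC _)).
        exact: cA _ _ (cM _ _ ccos ccos) (cN _ (cM _ _ csin csin)).
      * exact: (cM _ _ (cC _) (cM _ _ csin ccos)).
  - move=> t; rewrite diffE.
    have [h1 h2 _ _ _] := dlt _ (small _ t h).
    have etaE : eta * `|rho *: P t| <= rho * (S / 8).
      apply: (@le_trans _ _ (eta * (rho * N))).
        by rewrite ler_wpM2l ?(ltW eta0) // -{2}(gtr0_norm rho0) PN.
      by rewrite /eta le_eqVlt; apply/orP; left; apply/eqP; field; rewrite gt_eqF.
    have bnd (cc : V -> R^o) : 'd cc z (rho *: P t)
        = rho * (cos t * 'd cc z e1 + sin t * 'd cc z e2).
      have e : 'd cc z (rho *: P t) = rho * 'd cc z (P t) by exact: linearZ.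
      by rewrite e diffE.
    rewrite /f /Q diffE.
    apply: (@circle_flux_bound R (cos t) (sin t) _ _ _ _ (c1 z) (c2 z) a
      ('d c1 z e2) ('d c2 z e1) c rho); rewrite ?cos2Dsin2 ?cos_max ?sin_max //.
    + rewrite c1E; last exact: gD.
      by rewrite opprD addrA -bnd; exact: le_trans (d1P _ h1) etaE.
    + rewrite c2E; last exact: gD.
      by rewrite opprD addrA -bnd; exact: le_trans (d2P _ h2) etaE.
  - rewrite /F /= sin0 cos0 sin2pi cos2pi /g /P sin0 cos0 sin2pi cos2pi.
    rewrite ltrD2r ltrD2l mul0r !mulr0 !addr0 mulr0.
    apply: mulr_gt0 => //; apply: mulr_gt0; first exact: divr_gt0.
    by rewrite mulrn_wgt0 // pi_gt0.
move=> [rho [t [/andP[rho0 rhor]]]].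
rewrite {1}/g scale0r addr0 ltNge => /negP; apply; apply: d4P.
by have [] := dlt _ (small rho t _); rewrite // gtr0_norm.
Qed.

(** * Functions of class C^k *)

(** The class C^k on an open set only depends on the values on that set, although
    it is stated with total functions. *)
Lemma Ck_eq_on (R : realType) (V W : normedModType R) (D : set V) k
    (f g : V -> W) :
  open D -> (forall x, D x -> f x = g x) -> Ck k D f -> Ck k D g.
Proof.
move=> oD; elim: k f g => [|k IH] f g fg /=.
  move=> cf x Dx; rewrite /prop_for /continuous_at -(fg _ Dx).
  apply: cvg_trans (cf x Dx); apply: near_eq_cvg.
  by apply: filterS (open_nbhs_nbhs (conj oD Dx)) => y /fg.
move=> [df dfC]; split=> [x Dx|v].
  by have [] := diff_eq_on oD Dx fg (df _ Dx).
apply: IH (dfC v) => x Dx.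
by have [_ ->] := diff_eq_on oD Dx fg (df _ Dx).
Qed.

Lemma CkW (R : realType) (V W : normedModType R) (D : set V) k (f : V -> W) :
  Ck k.+1 D f -> Ck k D f.
Proof.
elim: k f => [|k IH] f [df dfC]; first by move=> x /df/differentiable_continuous.
by split=> // v; apply/IH/dfC.
Qed.

Lemma Ck_cst (R : realType) (V W : normedModType R) (D : set V) k (a : W) :
  Ck k D (fun=> a).
Proof.
elim: k a => [|k IH] a; first by move=> x _; exact: cst_continuous.
split=> // v; rewrite (_ : (fun=> _) = (fun=> 0)) //; apply/funext => x.
by rewrite diff_cst.
Qed.

Lemma Ck_linear (R : realType) (V W : normedModType R) (D : set V) k
    (l : {linear V -> W}) : continuous l -> Ck k D l.
Proof.
move=> cl; case: k => [|k]; first by move=> x _; exact: cl.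
split=> [x _|v]; first exact: linear_differentiable.
rewrite (_ : (fun=> _) = (fun=> l v)); first exact: Ck_cst.
by apply/funext => x; rewrite diff_lin.
Qed.

Lemma Ck_linear_comp (R : realType) (V W X : normedModType R) (D : set V) k
    (l : {linear W -> X}) (f : V -> W) :
  open D -> continuous l -> Ck k D f -> Ck k D (fun x => l (f x)).
Proof.
move=> oD cl; elim: k f => [|k IH] f.
  by move=> cf x Dx; apply: continuous_comp; [exact: cf | exact: cl].
move=> [df dfC].
have dl y : differentiable l y by exact: linear_differentiable.
split=> [x Dx|v]; first by apply: (differentiable_comp (g := l)) => //; exact: df.
apply: Ck_eq_on (IH _ (dfC v)) => // x Dx.
by rewrite (diff_comp_at v (df _ Dx) (dl (f x))) diff_lin.
Qed.

Lemma CkD (R : realType) (V W : normedModType R) (D : set V) k (f g : V -> W) :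
  open D -> Ck k D f -> Ck k D g -> Ck k D (fun x => f x + g x).
Proof.
move=> oD; elim: k f g => [|k IH] f g.
  by move=> cf cg x Dx; apply: cvgD; [exact: cf | exact: cg].
move=> [df dfC] [dg dgC]; split=> [x Dx|v].
  by apply: differentiableD; [exact: df | exact: dg].
apply: Ck_eq_on (IH _ _ (dfC v) (dgC v)) => // x Dx.
exact: esym (diffD_at v (df _ Dx) (dg _ Dx)).
Qed.

Lemma CkM (R : realType) (V : normedModType R) (D : set V) k (f g : V -> R^o) :
  open D -> Ck k D f -> Ck k D g -> Ck k D (fun x => f x * g x : R^o).
Proof.
move=> oD; elim: k f g => [|k IH] f g.
  by move=> cf cg x Dx; apply: cvgM; [exact: cf | exact: cg].
move=> Cf Cg; have [df dfC] := Cf; have [dg dgC] := Cg; split=> [x Dx|v].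
  by apply: differentiableM; [exact: df | exact: dg].
apply: Ck_eq_on (CkD oD (IH _ _ (CkW Cf) (dgC v)) (IH _ _ (CkW Cg) (dfC v))).
  by [].
move=> x Dx.
exact: esym (diffM_at v (df _ Dx) (dg _ Dx)).
Qed.

Lemma Ck_sum (R : realType) (V W : normedModType R) (D : set V) k n
    (f : 'I_n -> V -> W) :
  open D -> (forall i, Ck k D (f i)) -> Ck k D (fun x => \sum_i f i x).
Proof.
move=> oD Cf; elim: n f Cf => [|n IH] f Cf.
  by apply: Ck_eq_on (Ck_cst D k 0) => // x _; rewrite big_ord0.
apply: Ck_eq_on (CkD oD (IH _ (fun i => Cf (widen_ord (leqnSn n) i))) (Cf ord_max)).
  by [].
by move=> x _; rewrite big_ord_recr.
Qed.

Lemma linear_rowE (R : realType) (W : lmodType R) m (l : {linear 'rV[R]_m -> W})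
    (v : 'rV[R]_m) : l v = \sum_j v 0 j *: l (delta_mx 0 j).
Proof.
rewrite {1}(row_sum_delta v) linear_sum.
by apply: eq_bigr => j _; rewrite linearZ.
Qed.

Lemma Ck_entry (R : realType) (V : normedModType R) (D : set V) k m n
    (M : V -> 'M[R]_(m, n)) i j :
  open D -> Ck k D M -> Ck k D (fun x => M x i j : R^o).
Proof.
move=> oD CM.
have lin : linear (fun N : 'M[R]_(m, n) => N i j : R^o).
  by move=> a A B; rewrite !mxE.
pose l : {linear 'M[R]_(m, n) -> R^o} := HB.pack (fun N : 'M[R]_(m, n) => N i j : R^o)
  (GRing.isLinear.Build _ _ _ _ _ lin).
have cl : continuous l by exact: coord_continuous.
exact: (Ck_linear_comp oD cl CM).
Qed.

(** Stated for maps into row vectors, since the continuity of the derivative is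
    checked on coordinates. *)
Lemma Ck1_comp (R : realType) (V : normedModType R) m (D : set V)
    (B : set 'rV[R]_m) (f : V -> 'rV[R]_m) (r : 'rV[R]_m -> R^o) :
  open D -> f @` D `<=` B -> Ck 1 D f -> Ck 1 B r ->
  Ck 1 D (fun x => r (f x)) /\
  forall x v, D x -> 'd (fun x => r (f x)) x v = 'd r (f x) ('d f x v).
Proof.
move=> oD fB [df cdf] [dr cdr].
have Bf x : D x -> B (f x) by move=> Dx; apply: fB; exists x.
have dE x v : D x -> 'd (fun x => r (f x)) x v = 'd r (f x) ('d f x v).
  by move=> Dx; exact: diff_comp_at (df _ Dx) (dr _ (Bf _ Dx)).
split=> //; split=> [x Dx|v].
  by apply: (@differentiable_comp _ _ _ _ f r); [exact: df | exact/dr/Bf].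
apply: (@Ck_eq_on _ _ _ _ 0 (fun x => \sum_j ('d f x v) 0 j *
   'd r (f x) (delta_mx 0 j) : R^o)) => //.
  by move=> x Dx; rewrite dE // [RHS]linear_rowE.
apply: Ck_sum => // j; apply: CkM => //.
  by apply: Ck_entry => //; exact: cdf.
move=> x Dx; apply: (@continuous_comp _ _ _ f (fun y => 'd r y (delta_mx 0 j))).
  exact/differentiable_continuous/df.
exact/cdr/Bf.
Qed.

Lemma continuous_rV_linear (R : realType) m (l : {linear 'rV[R]_m -> R^o}) :
  continuous l.
Proof.
have : Ck 0 setT l.
  apply: (@Ck_eq_on _ _ _ setT 0 (fun w : 'rV[R]_m => \sum_j w 0 j * l (delta_mx 0 j) : R^o)).
  - exact: openT.
  - by move=> w _; rewrite [RHS]linear_rowE.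
  - apply: Ck_sum; first exact: openT.
    move=> j; apply: CkM; [exact: openT | | exact: Ck_cst].
    by apply: Ck_entry; [exact: openT | move=> x _; exact: cvg_id].
by move=> c w; exact: c.
Qed.

Lemma diff_linear_comp (R : realType) (V : normedModType R) m
    (l : {linear 'rV[R]_m -> R^o}) (f : V -> 'rV[R]_m) x v :
  differentiable f x -> 'd (fun x => l (f x)) x v = l ('d f x v).
Proof.
have cl := @continuous_rV_linear R m l.
move=> df; rewrite (diff_comp_at v df (linear_differentiable (f x) cl)).
by rewrite diff_lin.
Qed.

(** * The squared Euclidean norm *)

Lemma linear_coord (R : realType) m (i : 'I_m) :
  linear (fun x : 'rV[R]_m => x 0 i : R^o).
Proof. by move=> a x y; rewrite !mxE. Qed.

Lemma Ck_coord (R : realType) m k (D : set 'rV[R]_m) i :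
  Ck k D (fun x : 'rV[R]_m => x 0 i : R^o).
Proof.
pose l : {linear 'rV[R]_m -> R^o} := HB.pack (fun x : 'rV[R]_m => x 0 i : R^o)
  (GRing.isLinear.Build _ _ _ _ _ (linear_coord i)).
exact: (Ck_linear D k (@continuous_rV_linear R m l)).
Qed.

Lemma diff_coord (R : realType) m i (x v : 'rV[R]_m) :
  'd (fun x : 'rV[R]_m => x 0 i : R^o) x v = v 0 i.
Proof.
pose l : {linear 'rV[R]_m -> R^o} := HB.pack (fun x : 'rV[R]_m => x 0 i : R^o)
  (GRing.isLinear.Build _ _ _ _ _ (linear_coord i)).
exact: (congr1 (fun g : 'rV[R]_m -> R => g v)
  (diff_lin x (@continuous_rV_linear R m l))).
Qed.

(** The norm of row vectors is the sup norm, whose square is not smooth. *)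
Definition sqnorm (R : realType) m (x : 'rV[R]_m) : R^o := \sum_i x 0 i ^+ 2.

Lemma Ck_sqnorm (R : realType) m k (D : set 'rV[R]_m) :
  open D -> Ck k D (@sqnorm R m).
Proof.
by move=> oD; apply: Ck_sum => // i; apply: CkM => //; exact: Ck_coord.
Qed.

Lemma continuous_sqnorm (R : realType) m : continuous (@sqnorm R m).
Proof. by move=> x; exact: (@Ck_sqnorm R m 0 setT openT x I). Qed.

Lemma diff_sqnorm (R : realType) m (x v : 'rV[R]_m) :
  'd (@sqnorm R m) x v = \sum_i 2 * x 0 i * v 0 i.
Proof.
pose c i (y : 'rV[R]_m) : R^o := y 0 i.
have dc i : differentiable (c i) x by have [d _] := @Ck_coord R m 1 setT i; exact: d.
have E : @sqnorm R m = \sum_i (fun y => c i y * c i y).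
  by apply/funext => y; rewrite fct_sumE.
have ds : differentiable (@sqnorm R m) x.
  by have [d _] := @Ck_sqnorm R m 1 setT openT; exact: d.
rewrite -deriveE // E derive_sum; last first.
  by move=> i; apply: diff_derivable; exact: differentiableM.
apply: eq_bigr => i _; rewrite deriveE; last exact: differentiableM.
by rewrite (diffM_at v (dc i) (dc i)) diff_coord /c; ring.
Qed.

Lemma diff2_sqnorm (R : realType) m (z v w : 'rV[R]_m) :
  'd (fun x => 'd (@sqnorm R m) x w : R^o) z v = \sum_i 2 * v 0 i * w 0 i.
Proof.
pose g (x : 'rV[R]_m) : R^o := \sum_i 2 * x 0 i * w 0 i.
have -> : (fun x => 'd (@sqnorm R m) x w : R^o) = g.
  by apply/funext => x; exact: diff_sqnorm.
have lin : linear g.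
  move=> a x y; transitivity (a * (\sum_i 2 * x 0 i * w 0 i) + g y); last by [].
  rewrite mulr_sumr -big_split.
  by apply: eq_bigr => i _ /=; rewrite !mxE; ring.
pose l : {linear 'rV[R]_m -> R^o} := HB.pack g (GRing.isLinear.Build _ _ _ _ _ lin).
exact: (congr1 (fun h : 'rV[R]_m -> R => h v)
  (diff_lin z (@continuous_rV_linear R m l))).
Qed.

(** * The Levi form as a quadratic form *)

Lemma Ck_Jstar_d (R : realType) n (D : set (Cn R n)) k
    (J : Cn R n -> 'M[R]_(n + n)) (r : Cn R n -> R) w :
  open D -> Ck k D J -> Ck k.+1 D (r : _ -> R^o) ->
  Ck k D (fun x => Jstar_d J r x w : R^o).
Proof.
move=> oD CJ [dr Cr].
apply: (@Ck_eq_on _ _ _ _ _ (fun x => \sum_j (\sum_i w 0 i * J x i j)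
   * 'd (r : _ -> R^o) x (delta_mx 0 j) : R^o)) => //.
  move=> x Dx; rewrite /Jstar_d linear_rowE; apply: eq_bigr => j _.
  by rewrite mxE.
apply: Ck_sum => // j; apply: CkM => //; last exact: Cr.
apply: Ck_sum => // i; apply: CkM => //; first exact: Ck_cst.
exact: Ck_entry.
Qed.

(** The matrix of the Levi form. With T_i = (J^* dr)(e_i), the coefficient of
    d(J^* dr) on (e_j, e_i) is d_j T_i - d_i T_j, and the second vector is
    multiplied by J. It is in general not symmetric. *)
Definition levi_mx (R : realType) n (J : Cn R n -> 'M[R]_(n + n))
    (r : Cn R n -> R) (p : Cn R n) : 'M[R]_(n + n) :=
  let T i x : R^o := Jstar_d J r x (delta_mx 0 i) in
  \matrix_(i, k) \sum_j J p k j *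
    ('d (T i) p (delta_mx 0 j) - 'd (T j) p (delta_mx 0 i)).

Lemma Ck_levi_mx (R : realType) n (D : set (Cn R n))
    (J : Cn R n -> 'M[R]_(n + n)) (r : Cn R n -> R) k i j :
  open D -> Ck k.+1 D J -> Ck k.+2 D (r : _ -> R^o) ->
  Ck k D (fun p => levi_mx J r p i j : R^o).
Proof.
move=> oD CJ Cr.
have CT l v : Ck k D (fun p => 'd (fun x => Jstar_d J r x (delta_mx 0 l) : R^o) p v).
  by have [_] := Ck_Jstar_d (delta_mx 0 l) oD CJ Cr; exact.
apply: (@Ck_eq_on _ _ _ _ _ (fun p => \sum_l J p j l *
    ('d (fun x => Jstar_d J r x (delta_mx 0 i) : R^o) p (delta_mx 0 l)
     + (-1) * 'd (fun x => Jstar_d J r x (delta_mx 0 l) : R^o) p (delta_mx 0 i))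
     : R^o)) => //.
  by move=> p Dp; rewrite mxE; apply: eq_bigr => l _; rewrite mulN1r.
apply: Ck_sum => // l; apply: CkM => //; first exact/Ck_entry/CkW.
by apply: CkD => //; apply: CkM => //; exact: Ck_cst.
Qed.

Lemma diff_Jstar_d (R : realType) n (D : set (Cn R n))
    (J : Cn R n -> 'M[R]_(n + n)) (r : Cn R n -> R) p v w :
  open D -> D p -> Ck 1 D J -> Ck 2 D (r : _ -> R^o) ->
  'd (fun x => Jstar_d J r x w : R^o) p v =
    \sum_j w 0 j * 'd (fun x => Jstar_d J r x (delta_mx 0 j) : R^o) p v.
Proof.
move=> oD Dp CJ Cr.
have dT u : differentiable (fun x => Jstar_d J r x u : R^o) p.
  by have [+ _] := Ck_Jstar_d u oD CJ Cr; exact.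
have E : (fun x => Jstar_d J r x w : R^o) =
    \sum_j (w 0 j *: (fun x => Jstar_d J r x (delta_mx 0 j) : R^o)).
  apply/funext => x; rewrite fct_sumE.
  have lin : linear (fun u => Jstar_d J r x u : R^o).
    by move=> a A B; rewrite /Jstar_d mulmxDl -scalemxAl linearP.
  pose l : {linear Cn R n -> R^o} := HB.pack (fun u => Jstar_d J r x u : R^o)
    (GRing.isLinear.Build _ _ _ _ _ lin).
  exact: (linear_rowE l w).
rewrite -deriveE // E derive_sum; last first.
  by move=> j; apply/derivableZ/diff_derivable.
apply: eq_bigr => j _; rewrite deriveZ; last exact/diff_derivable.
by rewrite deriveE.
Qed.

Lemma levi_formE (R : realType) n (D : set (Cn R n))
    (J : Cn R n -> 'M[R]_(n + n)) (r : Cn R n -> R) p v :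
  open D -> D p -> Ck 1 D J -> Ck 2 D (r : _ -> R^o) ->
  levi_form J r p v = \sum_i \sum_k v 0 i * v 0 k * levi_mx J r p i k.
Proof.
move=> oD Dp CJ Cr; rewrite /levi_form /dform.
pose T i x : R^o := Jstar_d J r x (delta_mx 0 i).
have dE u w : 'd (fun x => Jstar_d J r x w : R^o) p u =
    \sum_i \sum_j u 0 i * w 0 j * 'd (T j) p (delta_mx 0 i).
  rewrite (diff_Jstar_d _ _ oD Dp CJ Cr) exchange_big; apply: eq_bigr => j _.
  rewrite linear_rowE big_distrr; apply: eq_bigr => i _ /=.
  by rewrite /GRing.scale /=; ring.
rewrite !dE opprB.
rewrite exchange_big -sumrB; apply: eq_bigr => i _ /=.
rewrite -sumrB.
under [RHS]eq_bigr do rewrite mxE big_distrr.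
rewrite exchange_big; apply: eq_bigr => j _ /=.
rewrite mxE !(big_distrl, big_distrr) -sumrB /=; apply: eq_bigr => k _ /=.
by rewrite -/(T i) -/(T j); ring.
Qed.

Lemma levi_form_mxE (R : realType) n (D : set (Cn R n))
    (J : Cn R n -> 'M[R]_(n + n)) (r : Cn R n -> R) p v :
  open D -> D p -> Ck 1 D J -> Ck 2 D (r : _ -> R^o) ->
  levi_form J r p v = (v *m levi_mx J r p *m v^T) 0 0.
Proof.
move=> oD Dp CJ Cr; rewrite (levi_formE v oD Dp CJ Cr) exchange_big mxE.
apply: eq_bigr => k _; rewrite !mxE big_distrl; apply: eq_bigr => i _ /=.
by rewrite mulrAC.
Qed.

Definition grad (R : realType) m (r : 'rV[R]_m -> R^o) (p : 'rV[R]_m) : 'cV[R]_m :=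
  \col_j 'd r p (delta_mx 0 j).

Lemma diff_grad (R : realType) m (r : 'rV[R]_m -> R^o) p v :
  'd r p v = (v *m grad r p) 0 0.
Proof. by rewrite linear_rowE mxE; apply: eq_bigr => j _; rewrite mxE. Qed.

Lemma diff_lincomb (R : realType) (V : normedModType R) (r s : V -> R^o)
    (a b c : R) x w : differentiable r x -> differentiable s x ->
  'd (fun x => a * r x + (b * s x + c) : R^o) x w = a * 'd r x w + b * 'd s x w.
Proof.
move=> dr ds; have da : differentiable (fun x => a * r x : R^o) x.
  exact: (differentiableZ a dr).
have db : differentiable (fun x => b * s x : R^o) x.
  exact: (differentiableZ b ds).
have [dbc dbcE] := diffB_cst_at (- c) w db; rewrite opprK in dbc dbcE.
apply: etrans (diffD_at w da dbc) _.
congr (_ + _); first exact: diffZ_at dr.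
by apply: etrans dbcE _; exact: diffZ_at ds.
Qed.

Lemma levi_form_lincomb (R : realType) n (Omega : set (Cn R n))
    (J : Cn R n -> 'M[R]_(n + n)) (r s : Cn R n -> R^o) (a b c : R) p v :
  open Omega -> Omega p -> Ck 1 Omega J -> Ck 2 Omega r -> Ck 2 Omega s ->
  levi_form J (fun x => a * r x + (b * s x + c)) p v =
    a * levi_form J r p v + b * levi_form J s p v.
Proof.
move=> oO Op CJ Cr Cs.
have [dr _] := Cr; have [ds _] := Cs.
have dE x w : Omega x -> 'd (fun x => a * r x + (b * s x + c) : R^o) x w =
    a * 'd r x w + b * 'd s x w.
  by move=> Ox; exact: diff_lincomb (dr _ Ox) (ds _ Ox).
have dJ w u : 'd (fun x => Jstar_d J (fun x => a * r x + (b * s x + c)) x w : R^o) p u =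
    a * 'd (fun x => Jstar_d J r x w : R^o) p u
    + b * 'd (fun x => Jstar_d J s x w : R^o) p u.
  have [dJr _] := Ck_Jstar_d w oO CJ Cr.
  have [dJs _] := Ck_Jstar_d w oO CJ Cs.
  have dar : differentiable (fun x => a * Jstar_d J r x w : R^o) p.
    exact: (differentiableZ a (dJr _ Op)).
  have dbs : differentiable (fun x => b * Jstar_d J s x w : R^o) p.
    exact: (differentiableZ b (dJs _ Op)).
  have dS := differentiableD dar dbs.
  have eqO y : Omega y ->
      ((fun x => a * Jstar_d J r x w : R^o) + (fun x => b * Jstar_d J s x w : R^o)) y =
      Jstar_d J (fun x => a * r x + (b * s x + c)) y w.
    by move=> Oy; exact: esym (dE y (w *m J y) Oy).
  have [_ E] := diff_eq_on oO Op eqO dS.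
  apply: etrans (E u) _; apply: etrans (diffD_at u dar dbs) _.
  by congr (_ + _); [exact: diffZ_at (dJr _ Op) | exact: diffZ_at (dJs _ Op)].
have alg (X X' A A' B B' : R) : X = a * A + b * B -> X' = a * A' + b * B' ->
    - (X - X') = a * - (A - A') + b * - (B - B').
  by move=> -> ->; ring.
exact: alg (dJ (v *m J p) v) (dJ v (v *m J p)).
Qed.

(** * The maximum principle along J-holomorphic discs *)

Definition ex (R : realType) : Cn R 1 := row_mx 1%:M 0.

Definition ey (R : realType) : Cn R 1 := row_mx 0 1%:M.

Lemma ex_Jst (R : realType) : ex R *m Jst = ey R.
Proof. by rewrite /ex Jst_mul_i oppr0. Qed.

Lemma ey_Jst (R : realType) : ey R *m Jst = - ex R.
Proof. by rewrite /ey Jst_mul_i opp_row_mx oppr0. Qed.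

Lemma open_udisc (R : realType) : open (@udisc R).
Proof.
rewrite (_ : udisc = (@sqnorm R (1 + 1)) @^-1` [set x | x < 1]) //.
by apply: open_comp; [move=> x _; exact: continuous_sqnorm | exact: open_lt].
Qed.

(** The Laplacian of r o f at z is the Levi form of r at f(z) on df(ex). Write
    theta for J^* dr and p = f(z). The differential of r o f is determined by
    f^* theta, and f^* theta(p) = ds with s = theta(p) o f. The difference
    f^* (theta - theta(p)) has coefficients (theta(f) - theta(p))(f_x) and
    (theta(f) - theta(p))(f_y), differentiable at z by
    [diff_sum_vanishing_mul], and its exterior derivative at z is
    d theta (f_x, f_y), that is, - L(r)(f_x), since f_y = J f_x. *)
Lemma levi_max_principle (R : realType) n (Omega : set (Cn R n))
    (J : Cn R n -> 'M[R]_(n + n)) (r : Cn R n -> R^o) (f : Cn R 1 -> Cn R n)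
    (h : Cn R 1 -> R^o) (z : Cn R 1) :
  open Omega -> Ck 1 Omega J -> Ck 2 Omega r ->
  f @` udisc `<=` Omega -> J_holomorphic J f -> Ck 2 udisc h ->
  udisc z -> (\forall x \near z, r (f x) + h x <= r (f z) + h z) ->
  levi_form J r (f z) ('d f z (ex R)) +
    ('d (fun x => 'd h x (ex R)) z (ex R) + 'd (fun x => 'd h x (ey R)) z (ey R))
  <= 0.
Proof.
move=> oO CJ Cr fO [Cf hol] Ch Dz zmax; rewrite leNgt; apply/negP => L0.
have oD := @open_udisc R.
have [CR dR] := Ck1_comp oD fO Cf (CkW Cr).
have Ch1 := CkW Ch.
have [dr Cdr] := Cr; have [df Cdf] := Cf; have [dh Cdh] := Ch.
have Of x : udisc x -> Omega (f x) by move=> Dx; apply: fO; exists x.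
set p := f z in zmax L0; have Op : Omega p by exact: Of.
pose th x w : R^o := Jstar_d J r x w.
have dth w : differentiable (fun x => th x w) p.
  by have [+ _] := Ck_Jstar_d w oO CJ Cr; exact.
have thlin x : linear (th x).
  by move=> a A B; rewrite /th /Jstar_d mulmxDl -scalemxAl linearP.
pose thl x : {linear Cn R n -> R^o} := HB.pack (th x)
  (GRing.isLinear.Build _ _ _ _ _ (thlin x)).
have thE x w : th x w = \sum_j w 0 j * th x (delta_mx 0 j).
  exact: (linear_rowE (thl x) w).
(* The exact part of f^* theta. *)
pose s x := thl p (f x).
have Cs : Ck 1 udisc s by apply: Ck_linear_comp => //; exact: continuous_rV_linear.
have dsE x v : udisc x -> 'd s x v = th p ('d f x v).
  by move=> Dx; exact: (diff_linear_comp (thl p) v (df _ Dx)).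
pose u x : R^o := r (f x) + h x.
have Cu : Ck 1 udisc u by exact: CkD.
have duE x v : udisc x -> 'd u x v = 'd r (f x) ('d f x v) + 'd h x v.
  move=> Dx; have [dRf _] := CR; rewrite -dR //.
  exact: (diffD_at v (dRf _ Dx) (dh _ Dx)).
pose K j x : R^o := th (f x) (delta_mx 0 j) - th p (delta_mx 0 j).
have dK j : differentiable (K j) z /\ forall v,
    'd (K j) z v = 'd (fun x => th x (delta_mx 0 j)) p ('d f z v).
  pose Th y := th y (delta_mx 0 j).
  have dTf : differentiable (Th \o f) z.
    exact: differentiable_comp (df _ Dz) (dth _).
  split=> [|v]; first by have [] := diffB_cst_at (th p (delta_mx 0 j)) 0 dTf.
  have [_ E] := diffB_cst_at (th p (delta_mx 0 j)) v dTf.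
  exact: etrans E (diff_comp_at v (df _ Dz) (dth _)).
have K0 j : K j z = 0 by rewrite /K subrr.
have cdf e j : {for z, continuous (fun x => ('d f x e) 0 j : R^o)}.
  exact: (@Ck_entry R _ udisc 0 _ _ (fun x => 'd f x e) 0 j oD (Cdf e) z Dz).
have [dS2 S2E] := diff_sum_vanishing_mul (fun j => (dK j).1) K0 (cdf (ey R)).
have [dS1 S1E] := diff_sum_vanishing_mul (fun j => (dK j).1) K0 (cdf (ex R)).
pose S2 x : R^o := \sum_j K j x * ('d f x (ey R)) 0 j.
pose S1 x : R^o := \sum_j K j x * ('d f x (ex R)) 0 j.
have KE x (w : Cn R n) : \sum_j K j x * w 0 j = th (f x) w - th p w.
  by rewrite !(thE _ w) -sumrB; apply: eq_bigr => j _; rewrite /K; ring.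
have dhe e : differentiable (fun x => 'd h x e) z by have [+ _] := Cdh e; exact.
(* Here holomorphy enters: f_x = - f_y J and f_y = f_x J. *)
have they x : udisc x -> th (f x) ('d f x (ey R)) = - 'd r (f x) ('d f x (ex R)).
  by move=> Dx; rewrite /th /Jstar_d -hol // ey_Jst !linearN.
have thex x : udisc x -> th (f x) ('d f x (ex R)) = 'd r (f x) ('d f x (ey R)).
  by move=> Dx; rewrite /th /Jstar_d -hol // ex_Jst.
have dS2L : 'd S2 z (ex R) = 'd (fun x => th x ('d f z (ey R))) p ('d f z (ex R)).
  apply: etrans (S2E _) (esym (etrans (diff_Jstar_d _ _ oO Op CJ Cr) _)).
  by apply: eq_bigr => j _; congr (_ * _); apply: esym; exact: (dK j).2.
have dS1L : 'd S1 z (ey R) = 'd (fun x => th x ('d f z (ex R))) p ('d f z (ey R)).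
  apply: etrans (S1E _) (esym (etrans (diff_Jstar_d _ _ oO Op CJ Cr) _)).
  by apply: eq_bigr => j _; congr (_ * _); apply: esym; exact: (dK j).2.
have leviE : levi_form J r p ('d f z (ex R)) =
    - ('d (fun x => th x ('d f z (ey R))) p ('d f z (ex R))
       - 'd (fun x => th x ('d f z (ex R))) p ('d f z (ey R))).
  by rewrite /levi_form /dform -hol // ex_Jst.
have alg2 (u1 s1 r1 h1 t tp S : R) : u1 = r1 + h1 -> s1 = tp -> S = t - tp ->
    t = - r1 -> u1 + s1 = h1 - S.
  by move=> -> -> -> ->; ring.
have alg1 (u1 s1 r1 h1 t tp S : R) : u1 = r1 + h1 -> s1 = tp -> S = t - tp ->
    t = r1 -> u1 - s1 = h1 + S.
  by move=> -> -> -> ->; ring.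
have alg (L A B X1 X2 H1 H2 : R) : X1 = H1 - A -> X2 = H2 + B ->
    L = - (A - B) -> 0 < L + (H1 + H2) -> 0 < X1 + X2.
  move=> -> -> ->; rewrite (_ : _ + (H1 + H2) = H1 - A + (H2 + B)) //; ring.
apply: (@weak_laplacian_no_max R _ z (ex R) (ey R) udisc u s
  (fun x => 'd h x (ex R) - S2 x) (fun x => 'd h x (ey R) + S1 x)).
- exact: (open_nbhs_nbhs (conj oD Dz)).
- exact: Cu.
- exact: Cs.
- by move=> x Dx; exact: alg2 (duE _ _ Dx) (dsE _ _ Dx) (KE _ _) (they _ Dx).
- by move=> x Dx; exact: alg1 (duE _ _ Dx) (dsE _ _ Dx) (KE _ _) (thex _ Dx).
- exact: differentiableB.
- exact: differentiableD.
- apply: alg leviE L0.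
  + rewrite -dS2L; exact: (diffB_at (ex R) (dhe _) dS2).
  + rewrite -dS1L; exact: (diffD_at (ey R) (dhe _) dS1).
- exact: zmax.
Qed.

(** * Norms and Lipschitz bounds *)

Lemma ler_entry_norm (R : realType) m n (A : 'M[R]_(m, n)) i j :
  `|A i j| <= `|A|.
Proof.
by rewrite [leRHS]/Num.norm /= mx_normrE; apply/bigmax_geP; right; exists (i, j).
Qed.

Lemma norm_mx_le (R : realType) m n (A : 'M[R]_(m, n)) (c : R) :
  0 <= c -> (forall i j, `|A i j| <= c) -> `|A| <= c.
Proof.
move=> c0 Ac; rewrite /Num.norm /= mx_normrE.
by apply/bigmax_leP; split=> // ij _; exact: Ac.
Qed.

Lemma norm_trmx_le (R : realType) m n (A : 'M[R]_(m, n)) : `|A^T| <= `|A|.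
Proof. by apply: norm_mx_le => // i j; rewrite mxE ler_entry_norm. Qed.

Lemma norm_mulmx_le (R : realType) m n p (A : 'M[R]_(m, n)) (B : 'M[R]_(n, p)) :
  `|A *m B| <= n%:R * `|A| * `|B|.
Proof.
apply: norm_mx_le => [|i j]; first by rewrite !mulr_ge0.
rewrite mxE; apply: le_trans (ler_norm_sum _ _ _) _.
apply: (@le_trans _ _ (\sum_(k < n) `|A| * `|B|)).
  by apply: ler_sum => k _; rewrite normrM ler_pM // ler_entry_norm.
by rewrite sumr_const card_ord -mulrA mulr_natl.
Qed.

Lemma norm_pair_le (R : realType) k (v : 'rV[R]_k) (g : 'cV[R]_k) :
  `|(v *m g) 0 0| <= k%:R * `|v| * `|g|.
Proof. exact: le_trans (ler_entry_norm _ _ _) (norm_mulmx_le _ _). Qed.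

Lemma norm_form_le (R : realType) k (v w : 'rV[R]_k) (M : 'M[R]_k) :
  `|(v *m M *m w^T) 0 0| <= k%:R ^+ 2 * `|M| * `|v| * `|w|.
Proof.
apply: le_trans (norm_pair_le _ _) _.
apply: (@le_trans _ _ (k%:R * (k%:R * `|v| * `|M|) * `|w|)).
  apply: ler_pM; rewrite ?norm_trmx_le ?mulr_ge0 //.
  by rewrite ler_wpM2l // norm_mulmx_le.
by rewrite le_eqVlt; apply/orP; left; apply/eqP; ring.
Qed.

Lemma sqr_norm_le (R : realType) m (v : 'rV[R]_m) : `|v| ^+ 2 <= sqnorm v.
Proof.
have s0 : 0 <= sqnorm v by apply: sumr_ge0 => i _; exact: sqr_ge0.
rewrite -(sqr_sqrtr s0) lerXn2r ?nnegrE ?sqrtr_ge0 //.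
apply: norm_mx_le => [|i j]; first exact: sqrtr_ge0.
rewrite -sqrtr_sqr ler_wsqrtr // ord1 /sqnorm (bigD1 j) //= lerDl.
by apply: sumr_ge0 => k _; exact: sqr_ge0.
Qed.

Lemma sqnorm_le (R : realType) m (x : 'rV[R]_m) : sqnorm x <= m%:R * `|x| ^+ 2.
Proof.
apply: (@le_trans _ _ (\sum_(i < m) `|x| ^+ 2)).
  apply: ler_sum => i _; rewrite -real_normK ?num_real //.
  by rewrite lerXn2r ?nnegrE // ler_entry_norm.
by rewrite sumr_const card_ord -[_ *+ m]mulr_natl.
Qed.

Lemma norm_diff_sqnorm_le (R : realType) m (x v : 'rV[R]_m) :
  `|'d (@sqnorm R m) x v| <= 2 * m%:R * `|x| * `|v|.
Proof.
rewrite diff_sqnorm; apply: le_trans (ler_norm_sum _ _ _) _.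
apply: (@le_trans _ _ (\sum_(i < m) 2 * `|x| * `|v|)).
  apply: ler_sum => i _; rewrite !normrM ger0_norm //.
  by rewrite -!mulrA ler_wpM2l // ler_pM // ler_entry_norm.
by rewrite sumr_const card_ord -[_ *+ m]mulr_natl le_eqVlt; apply/orP; left;
  apply/eqP; ring.
Qed.

Lemma uniform_bound_fin (R : realType) (I : finType) (P : I -> R -> R -> Prop) :
  (forall i C d C' d', P i C d -> C <= C' -> d' <= d -> P i C' d') ->
  (forall i, exists C d, [/\ 0 <= C, 0 < d & P i C d]) ->
  exists C d, [/\ 0 <= C, 0 < d & forall i, P i C d].
Proof.
move=> mono /fin_all_exists[C] /fin_all_exists[d] H.
exists (\sum_i C i), (\big[Num.min/1]_i d i); split.
- by apply: sumr_ge0 => i _; have [] := H i.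
- by elim/big_ind: _ => // [x y x0 y0|i _]; [rewrite lt_min x0 | have [] := H i].
- move=> i; have [_ _ Pi] := H i; apply: mono Pi _ _.
    by rewrite (bigD1 i) //= lerDl sumr_ge0 // => j _; have [] := H j.
  exact: bigmin_le_cond.
Qed.

(** The mean value theorem on segments, with the partial derivatives bounded near
    p0 by continuity. *)
Lemma Ck1_lipschitz (R : realType) m (D : set 'rV[R]_m) (g : 'rV[R]_m -> R^o)
    (p0 : 'rV[R]_m) :
  open D -> D p0 -> Ck 1 D g ->
  exists C d, [/\ 0 <= C, 0 < d & forall h k, `|h| < d -> `|k| < d ->
    `|g (p0 + h) - g (p0 + k)| <= C * `|h - k|].
Proof.
move=> oD Dp [dg Cg].
have H j : \forall x \near p0, `|'d g x (delta_mx 0 j)|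
    < `|'d g p0 (delta_mx 0 j)| + 1.
  have c : ('d g x (delta_mx 0 j) : R^o) @[x --> p0] -->
      ('d g p0 (delta_mx 0 j) : R^o) := Cg _ _ Dp.
  by apply: (cvgr_norm_lt _ c); rewrite ltrDl.
have := @filter_forall _ _ (fun j x => `|'d g x (delta_mx 0 j)|
    < `|'d g p0 (delta_mx 0 j)| + 1) _ (nbhs_filter p0) H.
move=> /nbhs_shift[d1 d1_gt0 d1P].
have [d2 d2_gt0 d2P] := nbhs_shift (open_nbhs_nbhs (conj oD Dp)).
pose C := \sum_j (`|'d g p0 (delta_mx 0 j)| + 1).
have C0 : 0 <= C by apply: sumr_ge0 => j _; rewrite addr_ge0.
exists C, (Num.min d1 d2); split=> // [|h k]; first by rewrite lt_min d1_gt0.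
rewrite !lt_min => /andP[h1 h2] /andP[k1 k2].
have seg (t : R) : 0 <= t <= 1 -> forall d, `|h| < d -> `|k| < d ->
    `|k + t *: (h - k)| < d.
  move=> t01 d hd kd; rewrite (_ : k + _ = (1 - t) *: k + t *: h); last first.
    by rewrite scalerBr scalerBl scale1r addrAC -addrA.
  apply: le_lt_trans (ler_normD _ _) _; rewrite !normrZ.
  rewrite [`|1 - t|]ger0_norm ?[`|t|]ger0_norm; [|lra..].
  have [->|t1] := eqVneq t 1; first by rewrite subrr mul0r add0r mul1r.
  rewrite (_ : d = (1 - t) * d + t * d); last by ring.
  apply: ltr_leD; first by rewrite ltr_pM2l // subr_gt0 lt_neqAle t1; lra.
  by rewrite ler_wpM2l ?(ltW hd) //; lra.
pose phi t := g (p0 + k + t *: (h - k)).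
have dphi (t : R) : 0 <= t <= 1 ->
    is_derive t 1 phi ('d g (p0 + k + t *: (h - k)) (h - k)).
  move=> t01; apply: (@is_derive_comp_diff _ _ _ g (fun t => p0 + k + t *: (h - k))).
    exact: is_derive_ray.
  by apply: dg; rewrite -addrA; exact/d2P/seg.
have dphi' (t : R) : t \in `]0, 1[%R ->
    is_derive t 1 phi ('d g (p0 + k + t *: (h - k)) (h - k)).
  by rewrite in_itv /= => t01; apply: dphi; lra.
have cphi : {within `[0, 1], continuous (phi : R -> R^o)}.
  apply: derivable_within_continuous => t; rewrite in_itv /= => t01.
  by have [] := dphi t t01.
have [t] := MVT ltr01 dphi' cphi.
rewrite in_itv /= subr0 mulr1 => t01.
rewrite /phi scale1r scale0r addr0 -addrA subrKC => ->.
rewrite linear_rowE; apply: le_trans (ler_norm_sum _ _ _) _.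
rewrite /C big_distrl; apply: ler_sum => j _ /=.
rewrite normrM mulrC; apply: ler_pM => //; last exact: ler_entry_norm.
have t01' : 0 <= t <= 1 by lra.
by have := d1P _ (seg _ t01' _ h1 k1) j; rewrite addrA => /ltW.
Qed.

Lemma Ck1_mx_lipschitz (R : realType) m (D : set 'rV[R]_m) a b
    (M : 'rV[R]_m -> 'M[R]_(a, b)) (p0 : 'rV[R]_m) :
  open D -> D p0 -> (forall i j, Ck 1 D (fun p => M p i j : R^o)) ->
  exists C d, [/\ 0 <= C, 0 < d & forall h k, `|h| < d -> `|k| < d ->
    `|M (p0 + h) - M (p0 + k)| <= C * `|h - k|].
Proof.
move=> oD Dp CM.
have [||C [d [C0 d0 H]]] := @uniform_bound_fin R ('I_a * 'I_b)%type
  (fun ij C d => forall h k, `|h| < d -> `|k| < d ->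
    `|M (p0 + h) ij.1 ij.2 - M (p0 + k) ij.1 ij.2| <= C * `|h - k|).
- move=> ij C d C' d' H CC dd h k hd kd.
  by apply: le_trans (H _ _ (lt_le_trans hd dd) (lt_le_trans kd dd)) _; rewrite ler_wpM2r.
- move=> [i j]; have [C [d [C0 d0 H]]] := Ck1_lipschitz oD Dp (CM i j).
  by exists C, d.
- exists C, d; split=> // h k hd kd; apply: norm_mx_le => [|i j].
    by rewrite mulr_ge0.
  by rewrite !mxE; exact: (H (i, j)).
Qed.

Lemma levi_mx_bounded (R : realType) n (Omega : set (Cn R n))
    (J : Cn R n -> 'M[R]_(n + n)) (r : Cn R n -> R^o) :
  open Omega -> Omega 0 -> Ck 2 Omega J -> Ck 3 Omega r ->
  exists B d, [/\ 0 <= B, 0 < d & forall p q, `|p| < d -> `|q| < d ->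
    [/\ Omega p, [/\ `|J p| <= B, `|grad r p| <= B & `|levi_mx J r p| <= B] &
     [/\ `|J p - J q| <= B * `|p - q|, `|grad r p - grad r q| <= B * `|p - q|
       & `|levi_mx J r p - levi_mx J r q| <= B * `|p - q| ]]].
Proof.
move=> oO O0 CJ Cr.
have CJ1 i j : Ck 1 Omega (fun p => J p i j : R^o).
  exact: Ck_entry (CkW CJ).
have Cg1 i j : Ck 1 Omega (fun p => grad r p i j : R^o).
  have [_ Cd] := CkW Cr; apply: (@Ck_eq_on _ _ _ Omega 1
    (fun p => 'd r p (delta_mx 0 i)) _ oO _ (Cd _)) => p _.
  by rewrite mxE.
have CM1 i j : Ck 1 Omega (fun p => levi_mx J r p i j : R^o).
  exact: Ck_levi_mx.
have [C1 [d1 [C10 d10 H1]]] := Ck1_mx_lipschitz oO O0 CJ1.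
have [C2 [d2 [C20 d20 H2]]] := Ck1_mx_lipschitz oO O0 Cg1.
have [C3 [d3 [C30 d30 H3]]] := Ck1_mx_lipschitz oO O0 CM1.
have [d4 d40 H4] := nbhs_shift (open_nbhs_nbhs (conj oO O0)).
have lip a b (M : Cn R n -> 'M[R]_(a, b)) C d B :
  (forall h k, `|h| < d -> `|k| < d -> `|M (0 + h) - M (0 + k)| <= C * `|h - k|) ->
  0 <= C -> 0 < d -> C <= B -> C * d + `|M 0| <= B ->
  forall p q, `|p| < d -> `|q| < d -> `|M p| <= B /\ `|M p - M q| <= B * `|p - q|.
  move=> H C0 d0 CB dB p q pd qd; split.
    rewrite -[M p](subrK (M 0)); apply: le_trans (ler_normD _ _) _.
    apply: le_trans dB; rewrite lerD2r.
    have := H p 0; rewrite normr0 !add0r subr0 => /(_ pd d0) /le_trans; apply.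
    by rewrite ler_wpM2l // ltW.
  have := H p q pd qd; rewrite !add0r => /le_trans; apply.
  by rewrite ler_wpM2r.
pose B1 := C1 + (C1 * d1 + `|J 0|); pose B2 := C2 + (C2 * d2 + `|grad r 0|).
pose B3 := C3 + (C3 * d3 + `|levi_mx J r 0|).
have [b1 b2 b3] : [/\ 0 <= C1 * d1 + `|J 0|, 0 <= C2 * d2 + `|grad r 0| &
    0 <= C3 * d3 + `|levi_mx J r 0|].
  by split; rewrite addr_ge0 // mulr_ge0 // ltW.
exists (B1 + B2 + B3), (Num.min (Num.min d1 d2) (Num.min d3 d4)); split.
- by rewrite /B1 /B2 /B3; move: C10 C20 C30 b1 b2 b3; clear; lra.
- by rewrite !lt_min d10 d20 d30 d40.
move=> p q; rewrite !lt_min => /andP[/andP[p1 p2] /andP[p3 p4]].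
move=> /andP[/andP[q1 q2] /andP[q3 q4]].
have [||x1 y1] := lip _ _ _ _ _ (B1 + B2 + B3) H1 C10 d10 _ _ p q p1 q1.
- by rewrite /B1 /B2 /B3; move: C20 C30 b1 b2 b3; clear; lra.
- by rewrite /B1 /B2 /B3; move: C10 C20 C30 b1 b2 b3; clear; lra.
have [||x2 y2] := lip _ _ _ _ _ (B1 + B2 + B3) H2 C20 d20 _ _ p q p2 q2.
- by rewrite /B1 /B2 /B3; move: C10 C30 b1 b2 b3; clear; lra.
- by rewrite /B1 /B2 /B3; move: C10 C20 C30 b1 b2 b3; clear; lra.
have [||x3 y3] := lip _ _ _ _ _ (B1 + B2 + B3) H3 C30 d30 _ _ p q p3 q3.
- by rewrite /B1 /B2 /B3; move: C10 C20 b1 b2 b3; clear; lra.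
- by rewrite /B1 /B2 /B3; move: C10 C20 C30 b1 b2 b3; clear; lra.
by split=> //; have := H4 _ p4; rewrite add0r.
Qed.

(** * The Levi form near a Levi-flat hypersurface *)

(** Correction of v into the kernel of both v |-> <v, g> and v |-> <vJ, g> by a
    vector w = a e + b eJ. The coefficients solve a 2 x 2 linear system with
    determinant - (s^2 + t^2), where s = <e, g> is bounded below. *)
Lemma complex_tangent_split (R : realType) k (J : 'M[R]_k) (g : 'cV[R]_k)
    (e v : 'rV[R]_k) (B : R) :
  J *m J = - 1%:M -> 0 <= B -> `|J| <= B -> `|g| <= B -> `|e| <= B ->
  1 / 2 <= (e *m g) 0 0 ->
  let K := k%:R in
  exists w, [/\ ((v - w) *m g) 0 0 = 0, ((v - w) *m J *m g) 0 0 = 0 &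
    `|w| <= 4 * (K * B ^+ 2 + K ^+ 2 * B ^+ 3) * (B + K * B ^+ 2) *
      (`|(v *m g) 0 0| + `|(v *m J *m g) 0 0|)].
Proof.
move=> JJ B0 JB gB eB s_ge K.
have K0 : 0 <= K by [].
pose s := (e *m g) 0 0; pose t := (e *m J *m g) 0 0.
set al := (v *m g) 0 0; set be := (v *m J *m g) 0 0.
pose De := s ^+ 2 + t ^+ 2.
have De4 : 1 / 4 <= De by rewrite -/s in s_ge; rewrite /De; nra.
have De0 : De != 0 by rewrite gt_eqF //; lra.
pose a := (al * s + be * t) / De; pose b := (al * t - be * s) / De.
pose w := a *: e + b *: (e *m J).
have eJB : `|e *m J| <= K * B ^+ 2.
  apply: le_trans (norm_mulmx_le _ _) _; rewrite expr2 mulrA.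
  by rewrite ler_pM ?mulr_ge0 // ler_wpM2l.
pose S := K * B ^+ 2 + K ^+ 2 * B ^+ 3.
have sS : `|s| <= S.
  apply: le_trans (norm_pair_le _ _) _; rewrite -/K.
  apply: (@le_trans _ _ (K * B * B)).
    by rewrite ler_pM ?mulr_ge0 // ler_wpM2l.
  by rewrite /S -mulrA -expr2 lerDl mulr_ge0 // exprn_ge0.
have tS : `|t| <= S.
  apply: le_trans (norm_pair_le _ _) _; rewrite -/K.
  apply: (@le_trans _ _ (K * (K * B ^+ 2) * B)).
    by rewrite ler_pM ?mulr_ge0 // ler_wpM2l.
  by rewrite (_ : _ * B = K ^+ 2 * B ^+ 3) ?lerDr ?mulr_ge0 ?exprn_ge0 //; ring.
have S0 : 0 <= S by exact: le_trans sS.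
have iDe : `|De^-1| <= 4.
  rewrite gtr0_norm ?invr_gt0; last by lra.
  by rewrite -[leRHS]invrK lef_pV2 ?posrE; lra.
have coef (x y x' y' : R) : `|x'| <= S -> `|y'| <= S ->
    `|(x * x' + y * y') / De| <= 4 * S * (`|x| + `|y|).
  move=> x'S y'S; rewrite normrM mulrC -mulrA.
  apply: ler_pM => //; apply: le_trans (ler_normD _ _) _.
  by rewrite !normrM mulrDr; apply: lerD; rewrite mulrC ler_wpM2r.
have aS : `|a| <= 4 * S * (`|al| + `|be|) by exact: coef.
have bS : `|b| <= 4 * S * (`|al| + `|be|).
  by rewrite /b -mulrN coef // normrN.
have lin (x y z : 'rV[R]_k) (c d : R) : ((x - (c *: y + d *: z)) *m g) 0 0 =
    (x *m g) 0 0 - (c * (y *m g) 0 0 + d * (z *m g) 0 0).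
  by rewrite mulmxBl mulmxDl -!scalemxAl !mxE.
exists w; split.
- rewrite lin -/s -/t -/al /a /b /De; field.
  exact: De0.
- have -> : (v - w) *m J = v *m J - (a *: (e *m J) + b *: (- e)).
    by rewrite mulmxBl mulmxDl -!scalemxAl -mulmxA JJ mulmxN mulmx1.
  rewrite lin mulNmx -/be -/t (_ : (- (e *m g)) 0 0 = - s); last by rewrite mxE.
  by rewrite /a /b /De; field; exact: De0.
rewrite -/S; apply: le_trans (ler_normD _ _) _.
rewrite (normrZ a) (normrZ b).
rewrite (_ : _ * _ * _ = 4 * S * (`|al| + `|be|) * B
  + 4 * S * (`|al| + `|be|) * (K * B ^+ 2)); last by ring.
by apply: lerD; apply: ler_pM.
Qed.

(** The linear algebra of [levi_flat_bound]. Unprimed matrices are taken at the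
    given point and primed ones at a nearby point of the hypersurface, at distance
    d, where the form M' vanishes on the complex tangent space. Changing the point
    costs O(d |v|^2), and splitting v = (v - w) + w as in
    [complex_tangent_split] leaves terms with a factor |w|. K1 and K3 bound w
    from the defect of tangency at the nearby point and that defect from |v|, and
    K2 compares the defects at both points. *)
Lemma levi_form_perturbation (R : realType) k (J J' M M' : 'M[R]_k)
    (g g' : 'cV[R]_k) (e : 'rV[R]_k) (B d : R) :
  J' *m J' = - 1%:M -> 0 <= B -> 0 <= d ->
  `|J| <= B -> `|g| <= B -> `|J'| <= B -> `|g'| <= B -> `|M'| <= B -> `|e| <= B ->
  `|J - J'| <= B * d -> `|g - g'| <= B * d -> `|M - M'| <= B * d ->
  1 / 2 <= (e *m g') 0 0 ->
  (forall v : 'rV[R]_k, (v *m g') 0 0 = 0 -> (v *m J' *m g') 0 0 = 0 ->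
    (v *m M' *m v^T) 0 0 = 0) ->
  let K := k%:R in
  let K1 := 4 * (K * B ^+ 2 + K ^+ 2 * B ^+ 3) * (B + K * B ^+ 2) in
  let K2 := K * B + 2 * K ^+ 2 * B ^+ 2 in
  let K3 := K * B + K ^+ 2 * B ^+ 2 in
  let K4 := K ^+ 2 * B * (2 + K1 * K3) * K1 in
  forall v : 'rV[R]_k, `|(v *m M *m v^T) 0 0| <=
    (K ^+ 2 * B + K4 * K2 + K4) * (d * `|v| ^+ 2
      + `|v| * (`|(v *m g) 0 0| + `|(v *m J *m g) 0 0|)).
Proof.
move=> JJ B0 d0 JB gB JB' gB' MB' eB dJ dg dM s_ge flat K K1 K2 K3 K4 v.
have K0 : 0 <= K by [].
have Bd0 : 0 <= B * d by exact: mulr_ge0.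
have [w [w1 w2 wK]] := complex_tangent_split v JJ B0 JB' gB' eB s_ge.
rewrite -/K -/K1 in wK.
set A := _ + _ in wK.
have p3 a b c a' b' c' : 0 <= a -> 0 <= b -> 0 <= c -> a <= a' -> b <= b' -> c <= c' ->
    a * b * c <= a' * b' * c' :> R.
  by move=> a0 b0 c0 aa bb cc; apply: ler_pM => //; [exact: mulr_ge0 | exact: ler_pM].
have vJ (X : 'M[R]_k) x : `|X| <= x -> `|v *m X| <= K * `|v| * x.
  move=> Xx; apply: le_trans (norm_mulmx_le _ _) _; exact: p3.
have K1_0 : 0 <= K1 by rewrite !(mulr_ge0, addr_ge0, exprn_ge0).
have AK2 : A <= `|(v *m g) 0 0| + `|(v *m J *m g) 0 0| + K * `|v| * (B * d)
     + 2 * (K ^+ 2 * B * `|v| * (B * d)).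
  have E1 : (v *m g') 0 0 = (v *m g) 0 0 - (v *m (g - g')) 0 0.
    by rewrite mulmxBr !mxE; ring.
  have E2 : (v *m J' *m g') 0 0 = (v *m J *m g) 0 0
      - (v *m J *m (g - g')) 0 0 - (v *m (J - J') *m g') 0 0.
    by rewrite !(mulmxBr, mulmxBl) !mxE; ring.
  rewrite /A E1 E2.
  have n1 : `|(v *m (g - g')) 0 0| <= K * `|v| * (B * d).
    by apply: le_trans (norm_pair_le _ _) _; exact: p3.
  have n2 : `|(v *m J *m (g - g')) 0 0| <= K ^+ 2 * B * `|v| * (B * d).
    apply: le_trans (norm_pair_le _ _) _.
    rewrite (_ : K ^+ 2 * _ * _ = K * (K * `|v| * B)); last by ring.
    by apply: p3 => //; exact: vJ.
  have n3 : `|(v *m (J - J') *m g') 0 0| <= K ^+ 2 * B * `|v| * (B * d).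
    apply: le_trans (norm_pair_le _ _) _.
    rewrite (_ : K ^+ 2 * _ * _ * _ = K * (K * `|v| * (B * d)) * B); last by ring.
    by apply: p3 => //; exact: vJ.
  apply: le_trans (lerD (ler_normB _ _)
    (le_trans (ler_normB _ _) (lerD (ler_normB _ _) (lexx _)))) _.
  have alg (a x b y z X Y : R) : x <= X -> y <= Y -> z <= Y ->
      a + x + (b + y + z) <= a + b + X + 2 * Y.
    by clear; lra.
  exact: alg.
have AK3 : A <= K3 * `|v|.
  rewrite (_ : K3 * _ = K * `|v| * B + K * (K * `|v| * B) * B); last first.
    by rewrite /K3; ring.
  by apply: lerD; apply: le_trans (norm_pair_le _ _) _; apply: p3 => //; exact: vJ.
have K3_0 : 0 <= K3 by rewrite !(mulr_ge0, addr_ge0, exprn_ge0).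
have wv : `|w| <= K1 * K3 * `|v|.
  by apply: le_trans wK _; rewrite -mulrA ler_wpM2l.
have vwv : `|v - w| <= (1 + K1 * K3) * `|v|.
  by apply: le_trans (ler_normB _ _) _; rewrite mulrDl mul1r lerD.
have E : (v *m M *m v^T) 0 0 = (v *m (M - M') *m v^T) 0 0
    + ((v - w) *m M' *m w^T) 0 0 + (w *m M' *m v^T) 0 0.
  pose phi (X : 'M[R]_k) (x y : 'rV[R]_k) := (x *m X *m y^T) 0 0.
  have phil (X : 'M[R]_k) (x x' y : 'rV[R]_k) : phi X (x - x') y = phi X x y - phi X x' y.
    by rewrite /phi !mulmxBl !mxE.
  have phir (X : 'M[R]_k) (x y y' : 'rV[R]_k) : phi X x (y - y') = phi X x y - phi X x y'.
    by rewrite /phi linearB /= mulmxBr !mxE.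
  have phiX (X X' : 'M[R]_k) (x y : 'rV[R]_k) : phi (X - X') x y = phi X x y - phi X' x y.
    by rewrite /phi mulmxBr mulmxBl !mxE.
  have := flat _ w1 w2; rewrite -!/(phi _ _ _) !(phil, phir, phiX) => F.
  by rewrite -[LHS]subr0 -[X in _ - X]F; ring.
have f3 (X : 'M[R]_k) (x y : 'rV[R]_k) b : `|X| <= b -> `|(x *m X *m y^T) 0 0| <=
    K ^+ 2 * b * `|x| * `|y|.
  move=> Xb; apply: le_trans (norm_form_le _ _ _) _.
  by apply: p3; rewrite ?mulr_ge0 ?exprn_ge0 // ler_wpM2l ?exprn_ge0.
have AA0 : 0 <= A by rewrite addr_ge0.
have K4_0 : 0 <= K4 by rewrite !(mulr_ge0, addr_ge0, exprn_ge0).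
have K2_0 : 0 <= K2 by rewrite !(mulr_ge0, addr_ge0, exprn_ge0).
have T1 := f3 _ v v _ dM.
have T2 : `|((v - w) *m M' *m w^T) 0 0| <=
    K ^+ 2 * B * ((1 + K1 * K3) * `|v|) * (K1 * A).
  by apply: le_trans (f3 _ _ _ _ MB') _; apply: p3; rewrite ?mulr_ge0 ?exprn_ge0.
have T3 : `|(w *m M' *m v^T) 0 0| <= K ^+ 2 * B * (K1 * A) * `|v|.
  by apply: le_trans (f3 _ _ _ _ MB') _; apply: p3; rewrite ?mulr_ge0 ?exprn_ge0.
set Ap := `|(v *m g) 0 0| + _ in AK2 *.
have Ap0 : 0 <= Ap by rewrite addr_ge0.
rewrite E; apply: le_trans (ler_normD _ _) _.
apply: le_trans (lerD (le_trans (ler_normD _ _) (lerD T1 T2)) T3) _.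
apply: (@le_trans _ _ (K ^+ 2 * B * d * `|v| ^+ 2
    + K4 * `|v| * (Ap + K2 * (d * `|v|)))).
  rewrite [leLHS](_ : _ = K ^+ 2 * B * d * `|v| ^+ 2 + K4 * `|v| * A); last first.
    by rewrite /K4; ring.
  rewrite lerD2l; apply: ler_wpM2l; first exact: mulr_ge0.
  apply: le_trans AK2 _.
  by rewrite le_eqVlt; apply/orP; left; apply/eqP; rewrite /K2; ring.
rewrite -subr_ge0 (_ : (_ + _) * _ - _ = K ^+ 2 * B * (`|v| * Ap)
  + K4 * K2 * (`|v| * Ap) + K4 * (d * `|v| ^+ 2)); last by ring.
by rewrite !(addr_ge0, mulr_ge0, exprn_ge0).
Qed.

(** Points near 0 are moved to {r = 0} along e: r grows at least at speed 1/2 in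
    that direction, so r changes sign within distance 2 |r(p)| in the
    parameter. *)
Lemma zero_set_projection (R : realType) m (D : set 'rV[R]_m)
    (r : 'rV[R]_m -> R^o) (e : 'rV[R]_m) (d : R) :
  open D -> D 0 -> Ck 1 D r -> r 0 = 0 -> 'd r 0 e = 1 -> 0 < d ->
  exists2 d', 0 < d' & forall p, `|p| < d' -> exists q,
    [/\ `|q| < d, r q = 0, `|p - q| <= 2 * `|e| * `|r p| & 1 / 2 <= 'd r q e].
Proof.
move=> oD D0 [dr Cr] r0 dr0e d0.
have nD : \forall x \near (0 : 'rV[R]_m), D x.
  exact: open_nbhs_nbhs (conj oD D0).
have nde : \forall x \near (0 : 'rV[R]_m), 1 / 2 < 'd r x e.
  have c : ('d r x e : R^o) @[x --> (0 : 'rV[R]_m)] --> ('d r 0 e : R^o) := Cr _ _ D0.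
  by apply: (cvgr_gt _ c); rewrite dr0e; lra.
have [d1 d1_gt0 d1P] := nbhs_shift (filterI nD nde).
pose d2 := Num.min d d1; have d2_gt0 : 0 < d2 by rewrite lt_min d0.
have ball2 x : `|x| < d2 -> [/\ `|x| < d, D x & 1 / 2 < 'd r x e].
  by rewrite lt_min => /andP[-> /d1P]; rewrite add0r => -[].
(* With |r p| < eta, the segment of parameters up to 2 |r p| stays in the ball
   of radius d2. *)
pose eta := d2 / (4 * (`|e| + 1)).
have e1 : 0 < `|e| + 1 by rewrite ltr_pwDr.
have eta0 : 0 < eta by rewrite divr_gt0 // mulr_gt0.
have nr : \forall x \near (0 : 'rV[R]_m), `|r x| < eta.
  have c : r x @[x --> (0 : 'rV[R]_m)] --> r 0.
    exact: differentiable_continuous (dr _ D0).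
  by apply: (cvgr_norm_lt _ c); rewrite r0 normr0.
have [d3 d3_gt0 d3P] := nbhs_shift nr.
exists (Num.min d3 (d2 / 2)) => [|p]; first by rewrite lt_min d3_gt0 divr_gt0.
rewrite lt_min => /andP[/d3P]; rewrite add0r => rp pd2.
pose tau := 2 * `|r p|.
have tau0 : 0 <= tau by rewrite mulr_ge0.
have seg (t : R) : `|t| <= tau -> `|p + t *: e| < d2.
  move=> tt; apply: le_lt_trans (ler_normD _ _) _; rewrite normrZ.
  have : `|t| * `|e| <= 2 * eta * (`|e| + 1).
    apply: ler_pM => //; last by rewrite lerDl.
    by apply: le_trans tt _; rewrite /tau ler_wpM2l // ltW.
  rewrite (_ : 2 * eta * _ = d2 / 2); last by rewrite /eta; field; rewrite gt_eqF.
  by move: pd2; clear; lra.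
pose rho (t : R) := r (p + t *: e).
have drho (t : R) : `|t| <= tau -> is_derive t 1 rho ('d r (p + t *: e) e).
  move=> tt; apply: (@is_derive_comp_diff _ _ _ r (fun t : R => p + t *: e)).
    exact: is_derive_ray.
  by apply: dr; have [] := ball2 _ (seg _ tt).
have incr (x y : R) : - tau <= x -> x < y -> y <= tau -> (y - x) / 2 <= rho y - rho x.
  move=> xt xy yt.
  have drho' (t : R) : t \in `]x, y[%R -> is_derive t 1 rho ('d r (p + t *: e) e).
    by rewrite in_itv /= => /andP[xx yy]; apply: drho; rewrite ler_norml; lra.
  have crho : {within `[x, y], continuous (rho : R -> R^o)}.
    apply: derivable_within_continuous => t; rewrite in_itv /= => /andP[xx yy].
    by have [] : is_derive t 1 rho ('d r (p + t *: e) e)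
      by apply: drho; rewrite ler_norml; lra.
  have [t] := MVT xy drho' crho; rewrite in_itv /= => /andP[xx yy] ->.
  have tt : `|t| <= tau by rewrite ler_norml; lra.
  have [_ _ h] := ball2 _ (seg _ tt).
  by rewrite mulrC ler_pM2r ?subr_gt0 //; move: h; clear; lra.
have [t /andP[t1 t2] rt] : exists2 t : R, - tau <= t <= tau & rho t = 0.
  have [tau00|tau00] := eqVneq tau 0.
    exists 0; first by rewrite tau00; lra.
    rewrite /rho scale0r addr0; apply/eqP; rewrite -normr_eq0.
    by have := tau00; rewrite /tau => /eqP; rewrite mulf_eq0 pnatr_eq0.
  have taup : 0 < tau by rewrite lt_neqAle eq_sym tau00.
  have rho0 : rho 0 = r p by rewrite /rho scale0r addr0.
  have i1 := incr 0 tau _ _ _; have i2 := incr (- tau) 0 _ _ _.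
  have [ra rb] : r p <= `|r p| /\ - r p <= `|r p|.
    by rewrite ler_norm -normrN ler_norm.
  have up : 0 <= rho tau.
    have : (tau - 0) / 2 <= rho tau - rho 0 by apply: i1; lra.
    by rewrite rho0 /tau; move: ra rb; clear; lra.
  have lo : rho (- tau) <= 0.
    have : (0 - - tau) / 2 <= rho 0 - rho (- tau) by apply: i2; lra.
    by rewrite rho0 /tau; move: ra rb; clear; lra.
  have cont : {within `[- tau, tau], continuous (rho : R -> R^o)}.
    apply: derivable_within_continuous => t; rewrite in_itv /= => tt.
    by have [] : is_derive t 1 rho ('d r (p + t *: e) e)
      by apply: drho; rewrite ler_norml.
  have [] := @IVT R rho (- tau) tau 0 _ cont.
  - by lra.
  - by rewrite ge_min lo le_max up orbT.
  - by move=> t; rewrite in_itv /= => tt rt; exists t.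
have tt : `|t| <= tau by rewrite ler_norml t1.
have [h1 _ h3] := ball2 _ (seg _ tt).
exists (p + t *: e); split=> //; last exact: ltW.
rewrite opprD addNKr normrN normrZ (_ : 2 * _ * _ = tau * `|e|).
  by rewrite ler_wpM2r.
by rewrite /tau; ring.
Qed.

(** Each p near 0 is compared with a point q of the hypersurface at distance
    O(|r(p)|), where [levi_form_perturbation] applies. *)
Lemma levi_flat_bound (R : realType) n (Omega : set (Cn R n))
    (J : Cn R n -> 'M[R]_(n + n)) (r : Cn R n -> R^o) :
  open Omega -> Omega 0 -> Ck 2 Omega J ->
  (forall p, Omega p -> J p *m J p = - 1%:M) -> Ck 3 Omega r ->
  r 0 = 0 -> (exists v, 'd r 0 v != 0) ->
  (forall p v, Omega p -> r p = 0 -> complex_tangent_space J r p v ->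
     levi_form J r p v = 0) ->
  exists C d, [/\ 0 <= C, 0 < d & forall p, `|p| < d -> Omega p /\
    forall v, `|levi_form J r p v| <= C * (`|r p| * `|v| ^+ 2
      + `|v| * (`|'d r p v| + `|'d r p (v *m J p)|))].
Proof.
move=> oO O0 CJ JJ Cr r0 [v0 dr0] flat.
have CJ1 := CkW CJ; have Cr2 := CkW Cr.
have [B [d [B0 d0 H]]] := levi_mx_bounded oO O0 CJ Cr.
pose e := ('d r 0 v0)^-1 *: v0.
have dre : 'd r 0 e = 1.
  have -> : 'd r 0 e = ('d r 0 v0)^-1 * 'd r 0 v0 by exact: linearZ.
  by rewrite mulVf.
have [d' d'0 proj] := zero_set_projection oO O0 (CkW Cr2) r0 dre d0.
pose B' := B + `|e|.
have BB' : B <= B' by rewrite lerDl.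
have B'0 : 0 <= B' by exact: le_trans BB'.
have wk x y : 0 <= y -> x <= B * y -> x <= B' * y.
  by move=> y0 xy; apply: le_trans xy _; rewrite ler_wpM2r.
pose K : R := (n + n)%:R.
pose K1 := 4 * (K * B' ^+ 2 + K ^+ 2 * B' ^+ 3) * (B' + K * B' ^+ 2).
pose K2 := K * B' + 2 * K ^+ 2 * B' ^+ 2.
pose K3 := K * B' + K ^+ 2 * B' ^+ 2.
pose K4 := K ^+ 2 * B' * (2 + K1 * K3) * K1.
pose C := K ^+ 2 * B' + K4 * K2 + K4.
have K0 : 0 <= K by exact: ler0n.
have C0 : 0 <= C.
  by rewrite /C /K4 /K3 /K2 /K1 !(mulr_ge0, addr_ge0, exprn_ge0).
exists (C * (2 * `|e| + 1)), (Num.min d d'); split=> [||p].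
- by rewrite mulr_ge0 // addr_ge0 // mulr_ge0.
- by rewrite lt_min d0.
rewrite lt_min => /andP[pd /proj[q [qd rq pq dq]]].
have [Op [Jp gp Mp] [dJ dg dM]] := H p q pd qd.
have [Oq [Jq gq Mq] _] := H q p qd pd.
split=> // v; rewrite (levi_form_mxE v oO Op CJ1 Cr2) !diff_grad.
have flatq (w : Cn R n) : (w *m grad r q) 0 0 = 0 ->
    (w *m J q *m grad r q) 0 0 = 0 -> (w *m levi_mx J r q *m w^T) 0 0 = 0.
  move=> w1 w2; rewrite -(levi_form_mxE w oO Oq CJ1 Cr2); apply: flat => //.
  split; first by rewrite /tangent_space /= diff_grad.
  exists (- (w *m J q)); last by rewrite mulNmx -mulmxA JJ // mulmxN mulmx1 opprK.
  by rewrite /tangent_space /= diff_grad mulNmx mxE w2 oppr0.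
rewrite diff_grad in dq.
have := levi_form_perturbation (JJ _ Oq) B'0 (normr_ge0 (p - q))
  (le_trans Jp BB') (le_trans gp BB') (le_trans Jq BB') (le_trans gq BB')
  (le_trans Mq BB') _ (wk _ _ _ dJ) (wk _ _ _ dg) (wk _ _ _ dM) dq flatq v.
rewrite -/K -/K1 -/K2 -/K3 -/K4 -/C => /(_ _ _ _ _) h.
apply: le_trans (h _ _ _ _) _ => //; first by rewrite lerDr.
rewrite -mulrA; apply: ler_wpM2l => //; rewrite [leRHS]mulrDr; apply: lerD.
  rewrite [leRHS]mulrA; apply: ler_wpM2r; first exact: exprn_ge0.
  by apply: le_trans pq _; rewrite [leRHS]mulrDl mul1r lerDl.
by rewrite [leRHS]mulrDl mul1r lerDr !(mulr_ge0, addr_ge0).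
Qed.

(** * Strict plurisubharmonicity of the squared norm *)

(** As the differential of |x|^2 vanishes at 0, the derivatives of J do not
    contribute. *)
Lemma levi_sqnorm0 (R : realType) n (Omega : set (Cn R n))
    (J : Cn R n -> 'M[R]_(n + n)) v :
  open Omega -> Omega 0 -> Ck 1 Omega J -> J 0 *m J 0 = - 1%:M ->
  levi_form J (@sqnorm R (n + n)) 0 v =
    \sum_k 2 * (v 0 k ^+ 2 + (v *m J 0) 0 k ^+ 2).
Proof.
move=> oO O0 CJ JJ.
have dE (a w : Cn R n) : 'd (fun x => Jstar_d J (@sqnorm R (n + n)) x w : R^o) 0 a =
    \sum_k (w *m J 0) 0 k * (2 * a 0 k).
  pose K k (x : Cn R n) : R^o := 2 * x 0 k.
  pose W k (x : Cn R n) : R^o := (w *m J x) 0 k.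
  have -> : (fun x => Jstar_d J (@sqnorm R (n + n)) x w : R^o) =
      (fun x => \sum_k K k x * W k x : R^o).
    by apply/funext => x; rewrite /Jstar_d diff_sqnorm.
  have CK k : Ck 1 Omega (K k).
    by apply: CkM => //; [exact: Ck_cst | exact: Ck_coord].
  have dK k : differentiable (K k) 0 by have [d _] := CK k; exact: d.
  have dKE k : 'd (K k) 0 a = 2 * a 0 k.
    have [dc _] := @Ck_coord R (n + n) 1 Omega k.
    exact: etrans (diffZ_at 2 a (dc _ O0)) (congr1 _ (diff_coord _ _ _)).
  have K0 k : K k 0 = 0 by rewrite /K mxE mulr0.
  have cW k : {for 0, continuous (W k)}.
    have CW : Ck 0 Omega (W k).
      apply: (@Ck_eq_on _ _ _ Omega 0 (fun x => \sum_i w 0 i * J x i k : R^o)) => //.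
        by move=> x _; rewrite /W mxE.
      apply: Ck_sum => // i; apply: CkM => //; first exact: Ck_cst.
      exact: Ck_entry (CkW CJ).
    exact: CW.
  have [_ ->] := diff_sum_vanishing_mul dK K0 cW.
  by apply: eq_bigr => k _; rewrite dKE.
have vJJ : v *m J 0 *m J 0 = - v by rewrite -mulmxA JJ mulmxN mulmx1.
have -> : levi_form J (@sqnorm R (n + n)) 0 v =
    \sum_k (v *m J 0) 0 k * (2 * (v *m J 0) 0 k) - \sum_k (- v) 0 k * (2 * v 0 k).
  by rewrite -[RHS]opprB -{1}vJJ -!dE.
rewrite -sumrB.
apply: eq_bigr => k _; rewrite (_ : (- v) 0 k = - v 0 k); last by rewrite mxE.
by ring.
Qed.

Lemma levi_sqnorm_ge (R : realType) n (Omega : set (Cn R n))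
    (J : Cn R n -> 'M[R]_(n + n)) :
  open Omega -> Omega 0 -> Ck 2 Omega J -> J 0 *m J 0 = - 1%:M ->
  exists2 d, 0 < d & forall p v, `|p| < d ->
    `|v| ^+ 2 <= levi_form J (@sqnorm R (n + n)) p v.
Proof.
move=> oO O0 CJ JJ; have CJ1 := CkW CJ.
have Cs k : Ck k Omega (@sqnorm R (n + n)) by exact: Ck_sqnorm.
have [B [d [B0 d0 H]]] := levi_mx_bounded oO O0 CJ (Cs 3).
pose K : R := (n + n)%:R; have K0 : 0 <= K by exact: ler0n.
pose d' := 1 / (K ^+ 2 * B + 1).
have KB : 0 <= K ^+ 2 * B by rewrite mulr_ge0 // exprn_ge0.
have d'0 : 0 < d' by rewrite divr_gt0 // ltr_pwDr.
exists (Num.min d d') => [|p v]; first by rewrite lt_min d0.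
rewrite lt_min => /andP[pd pd'].
have [Op _ [_ _ dM]] := H p 0 pd ltac:(by rewrite normr0).
rewrite (levi_form_mxE v oO Op CJ1 (Cs 2)).
(* At 0 the bound holds with the factor 2; half of it is spent on moving to p. *)
have L0 : 2 * `|v| ^+ 2 <= (v *m levi_mx J (@sqnorm R (n + n)) 0 *m v^T) 0 0.
  rewrite -(levi_form_mxE v oO O0 CJ1 (Cs 2)) (levi_sqnorm0 v oO O0 CJ1 JJ).
  apply: (@le_trans _ _ (2 * sqnorm v)); first by rewrite ler_wpM2l ?sqr_norm_le.
  rewrite mulr_sumr; apply: ler_sum => k _.
  by rewrite ler_wpM2l // lerDl sqr_ge0.
have hd := norm_form_le v v
  (levi_mx J (@sqnorm R (n + n)) p - levi_mx J (@sqnorm R (n + n)) 0).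
rewrite -/K mulmxBr mulmxBl in hd; rewrite subr0 in dM.
set a := (v *m levi_mx _ _ p *m _) 0 0; set b := (v *m levi_mx _ _ 0 *m _) 0 0 in L0.
have {}hd : `|a - b| <= `|v| ^+ 2.
  have entryB (X Y : 'M[R]_1) : (X - Y) 0 0 = X 0 0 - Y 0 0 by rewrite !mxE.
  rewrite entryB in hd; apply: (le_trans hd).
  rewrite -mulrA -expr2 ler_piMl ?exprn_ge0 //.
  apply: (@le_trans _ _ (K ^+ 2 * (B * d'))).
    rewrite ler_wpM2l ?exprn_ge0 //; apply: le_trans dM _.
    by rewrite ler_wpM2l // ltW.
  by rewrite /d' mulrA mulrA mulr1 ler_pdivrMr ?mul1r ?lerDl // ltr_pwDr.
have alg (x y z : R) : - z <= x - y -> 2 * z <= y -> z <= x by clear; lra.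
move: hd; rewrite ler_norml => /andP[hd _]; exact: (alg a b _ hd L0).
Qed.

(** * Small Bishop discs *)

(** The final numerical contradiction: x is the norm of f_x, L and Lp are the Levi
    forms of the defining function and of |p|^2, and al, be are the derivatives of
    the defining function. The term m K x^2 wins against the errors of order m x^2,
    and 8 C eps x is split by 2 (2 C x) <= 1 + (2 C x)^2. *)
Lemma levi_estimates_incompatible (R : realType)
    (C K N B del m eps x rp al be L Lp : R) :
  K = C + 4 * C ^+ 2 + 1 -> 0 <= C -> 0 <= m -> 0 < eps -> 2 * eps <= m -> 0 <= x ->
  2 * C * K * N * del * (1 + N * B) <= 1 -> rp <= m ->
  al <= m * K * (2 * N * del * x) + eps * 4 ->
  be <= m * K * (2 * N * del * (N * x * B)) + eps * 4 ->
  - (C * (rp * x ^+ 2 + x * (al + be))) <= L -> x ^+ 2 <= Lp -> 0 <= K ->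
  L + m * K * Lp + (eps * 2 + eps * 2) <= 0 -> False.
Proof.
move=> KE C0 m0 eps0 epsm x0 CK rpm alE beE LE LpE K0 S.
have h1 : C * (rp * x ^+ 2) <= C * m * x ^+ 2.
  by rewrite -mulrA ler_wpM2l // ler_wpM2r // exprn_ge0.
have h2 : C * (x * (al + be)) <= m * x ^+ 2 + 8 * C * eps * x.
  have k2 : C * x * (al + be) <= C * x * (m * K * (2 * N * del * x) + eps * 4
      + (m * K * (2 * N * del * (N * x * B)) + eps * 4)).
    by apply: ler_wpM2l; [exact: mulr_ge0 | exact: lerD].
  have k1 : m * x ^+ 2 * (2 * C * K * N * del * (1 + N * B)) <= m * x ^+ 2.
    rewrite -[leRHS]mulr1.
    by rewrite ler_wpM2l // mulr_ge0 // exprn_ge0.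
  rewrite mulrA; apply: le_trans k2 _.
  rewrite -subr_ge0 (_ : _ - _ = m * x ^+ 2
    - m * x ^+ 2 * (2 * C * K * N * del * (1 + N * B))); last by ring.
  by rewrite subr_ge0.
have h3 : 8 * C * eps * x <= 2 * eps + 4 * C ^+ 2 * m * x ^+ 2.
  have k1 : 0 <= 2 * eps * (1 - 2 * C * x) ^+ 2.
    by apply: mulr_ge0 (sqr_ge0 _); apply: mulr_ge0 (ltW eps0).
  have k2 : 4 * C ^+ 2 * x ^+ 2 * (2 * eps) <= 4 * C ^+ 2 * x ^+ 2 * m.
    apply: ler_wpM2l epsm; apply: mulr_ge0 (sqr_ge0 _).
    exact: mulr_ge0 (sqr_ge0 _).
  rewrite -subr_ge0 (_ : _ - _ = 2 * eps * (1 - 2 * C * x) ^+ 2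
    + (4 * C ^+ 2 * x ^+ 2 * m - 4 * C ^+ 2 * x ^+ 2 * (2 * eps))); last by ring.
  by rewrite addr_ge0 // subr_ge0.
have h4 : m * K * x ^+ 2 <= m * K * Lp by rewrite ler_wpM2l // mulr_ge0.
have h5 : m * K * x ^+ 2 = C * m * x ^+ 2 + 4 * C ^+ 2 * m * x ^+ 2 + m * x ^+ 2.
  by rewrite KE; ring.
rewrite mulrDr in LE.
move: (C * m * _) (4 * C ^+ 2 * m * _) (m * x ^+ 2) (m * K * x ^+ 2) (m * K * Lp)
  (8 * C * eps * x) (C * (rp * _)) (C * (x * _)) h1 h2 h3 h4 h5 LE S eps0.
move=> y1 y2 y3 y4 y5 y6 y7 y8; clear; lra.
Qed.

Lemma norm_ex (R : realType) : `|ex R| <= 1.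
Proof.
apply: norm_mx_le => // i j; rewrite mxE; case: splitP => k _; rewrite !mxE.
  by rewrite !ord1 eqxx normr1.
by rewrite normr0.
Qed.

Lemma norm_ey (R : realType) : `|ey R| <= 1.
Proof.
apply: norm_mx_le => // i j; rewrite mxE; case: splitP => k _; rewrite !mxE.
  by rewrite normr0.
by rewrite !ord1 eqxx normr1.
Qed.

Lemma laplacian_sqnorm (R : realType) (z : Cn R 1) :
  'd (fun x => 'd (@sqnorm R (1 + 1)) x (ex R)) z (ex R) = 2 /\
  'd (fun x => 'd (@sqnorm R (1 + 1)) x (ey R)) z (ey R) = 2.
Proof.
split; apply: etrans (diff2_sqnorm _ _ _) _;
  by rewrite /ex /ey big_split_ord !big_ord1 /= !(row_mxEl, row_mxEr) !mxE eqxx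
    !(mulr1, mulr0, addr0, add0r).
Qed.

Lemma compact_udisc_closed (R : realType) : compact (@udisc_closed R).
Proof.
apply: bounded_closed_compact.
  exists 1; split; first exact: num_real.
  move=> x x1 z /= zD; apply: le_trans (ltW x1).
  rewrite -(@ler_pXn2r _ 2) ?nnegrE // expr1n.
  exact: le_trans (sqr_norm_le _) zD.
rewrite (_ : udisc_closed = (@sqnorm R (1 + 1)) @^-1` [set x | x <= 1]) //.
apply: closed_comp; last exact: closed_le.
by move=> x _; exact: continuous_sqnorm.
Qed.

(** The closed disc is the closure of the open one: (1 - t) z tends to z. *)
Lemma udisc_closed_image (R : realType) (V : normedModType R) (f : Cn R 1 -> V)
    (d : R) :
  {within udisc_closed, continuous f} -> (forall z, udisc z -> `|f z| <= d) ->
  forall z, udisc_closed z -> `|f z| <= d.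
Proof.
move=> /subspace_continuousP cf fd z zD; rewrite leNgt; apply/negP => dz.
have : nbhs z (fun x => udisc_closed x -> d < `|f x|).
  exact: (cvgr_norm_gt _ (cf z zD) _ dz).
move=> /nbhs_shift[e e0 H].
pose t := Num.min 1 (e / (2 * (`|z| + 1))).
have z1 : 0 < `|z| + 1 by rewrite ltr_pwDr.
have t0 : 0 < t by rewrite lt_min ltr01 divr_gt0 // mulr_gt0.
have t1 : t <= 1 by rewrite ge_min lexx.
have te : `|- (t *: z)| < e.
  rewrite normrN normrZ gtr0_norm //.
  apply: (@le_lt_trans _ _ (e / (2 * (`|z| + 1)) * (`|z| + 1))).
    by rewrite ler_pM ?(ltW t0) // ?lerDl // ge_min lexx orbT.
  rewrite (_ : _ * _ = e / 2); last by field; rewrite gt_eqF.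
  by move: e0; clear; lra.
have sE : sqnorm (z + - (t *: z)) = (1 - t) ^+ 2 * sqnorm z.
  by rewrite /sqnorm mulr_sumr; apply: eq_bigr => i _; rewrite !mxE; ring.
have szD : sqnorm z <= 1 by exact: zD.
have s0 : 0 <= sqnorm z by apply: sumr_ge0 => i _; exact: sqr_ge0.
have yD : udisc (z + - (t *: z)).
  rewrite /udisc /= -/(sqnorm _) sE.
  have t1' : (1 - t) ^+ 2 < 1.
    by rewrite expr_lt1 // ?subr_ge0 // gtrBl.
  by apply: le_lt_trans t1'; rewrite ler_piMr // exprn_ge0 // subr_ge0.
have := H _ te (ltW yD); rewrite ltNge => /negP; apply; exact: fd.
Qed.

(** The maximum principle for the disc, for sg r with sg = 1 or - 1: both signs
    share the estimates, which only involve absolute values. *)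
Lemma bishop_disc_one_sided (R : realType) n (Omega : set (Cn R n))
    (J : Cn R n -> 'M[R]_(n + n)) (r : Cn R n -> R^o) (B C d del sg : R)
    (f : Cn R 1 -> Cn R n) :
  let N : R := (n + n)%:R in let K := C + 4 * C ^+ 2 + 1 in
  open Omega -> Ck 2 Omega J -> Ck 2 Omega r ->
  0 <= B -> 0 <= C ->
  (forall p, `|p| < d -> [/\ Omega p, `|J p| <= B,
     forall v, `|levi_form J r p v| <= C * (`|r p| * `|v| ^+ 2
      + `|v| * (`|'d r p v| + `|'d r p (v *m J p)|)) &
     forall v, `|v| ^+ 2 <= levi_form J (@sqnorm R (n + n)) p v]) ->
  0 <= del < d -> K * (N * del ^+ 2) <= 1 / 2 ->
  2 * C * K * N * del * (1 + N * B) <= 1 ->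
  `|sg| = 1 ->
  J_holomorphic J f -> {within udisc_closed, continuous f} ->
  (forall z, udisc z -> `|f z| <= del) ->
  (forall z, udisc_boundary z -> r (f z) = 0) ->
  forall z, udisc z -> sg * r (f z) <= 0.
Proof.
move=> N K oO CJ Cr B0 C0 H /andP[del0 deld] Kdel CKdel sg1 hol cf fdel fbd z1 z1D.
rewrite leNgt; apply/negP => a0; set a := sg * r (f z1) in a0.
have N0 : 0 <= N by exact: ler0n.
have K1 : 1 <= K by rewrite /K lerDr addr_ge0 // mulr_ge0 // exprn_ge0.
have K0 : 0 <= K by exact: le_trans K1.
have fdel' := udisc_closed_image cf fdel.
have fd z : udisc_closed z -> `|f z| < d.
  by move=> zD; exact: le_lt_trans (fdel' _ zD) deld.
(* On the circle F = eps / w <= 2 eps = a / 2 < F z1, so that the maximum is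
   attained inside. *)
pose eps := a / 4.
have eps0 : 0 < eps by rewrite divr_gt0.
pose w (p : Cn R n) : R := 1 - K * sqnorm p.
have sq0 m (x : 'rV[R]_m) : 0 <= sqnorm x.
  by apply: sumr_ge0 => i _; exact: sqr_ge0.
have w_ge p : `|p| <= del -> 1 / 2 <= w p.
  move=> pdel; have : K * sqnorm p <= 1 / 2.
    apply: le_trans Kdel; apply: ler_wpM2l => //.
    apply: le_trans (sqnorm_le _) _; apply: ler_wpM2l => //.
    by rewrite lerXn2r ?nnegrE.
  by rewrite /w; clear; lra.
have w_le p : w p <= 1 by rewrite /w gerBl mulr_ge0.
have w_gt p : `|p| <= del -> 0 < w p.
  by move=> /w_ge; apply: lt_le_trans; rewrite divr_gt0.
pose F z := (sg * r (f z) + eps * sqnorm z) / w (f z).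
have cF : {within udisc_closed, continuous (F : Cn R 1 -> R^o)}.
  apply/subspace_continuousP => z zD.
  have cfz : f x @[x --> within udisc_closed (nbhs z)] --> f z.
    by move/subspace_continuousP: cf; exact.
  have [Oz _ _ _] := H _ (fd _ zD).
  have [dr _] := Cr.
  have crz : r (f x) @[x --> within udisc_closed (nbhs z)] --> r (f z).
    apply: (cvg_comp _ _ cfz); exact: differentiable_continuous (dr _ Oz).
  have csz : sqnorm (f x) @[x --> within udisc_closed (nbhs z)] --> sqnorm (f z).
    by apply: (cvg_comp _ _ cfz); exact: continuous_sqnorm.
  have csq : sqnorm x @[x --> within udisc_closed (nbhs z)] --> sqnorm z.
    by apply: cvg_within_filter; exact: continuous_sqnorm.
  apply: cvgM.
    by apply: cvgD; apply: cvgM => //; exact: cvg_cst.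
  apply: cvgV; first by rewrite gt_eqF // w_gt // fdel'.
  by apply: cvgB; [exact: cvg_cst | apply: cvgM => //; exact: cvg_cst].
have sub (z : Cn R 1) : udisc z -> udisc_closed z by move=> /ltW.
have [z0 z0A zmax] := @EVT_max_rV R (1 + 1) F (@udisc_closed R)
  (ex_intro _ z1 (sub _ z1D)) (@compact_udisc_closed R) cF.
rewrite inE in z0A.
have z1A : z1 \in udisc_closed by rewrite inE; exact: sub.
pose m := F z0.
have am : a <= m.
  apply: le_trans (zmax _ z1A); rewrite /F ler_pdivlMr; last exact/w_gt/fdel.
  apply: (@le_trans _ _ (a * 1)); first by rewrite ler_wpM2l // ltW.
  by rewrite mulr1 lerDl mulr_ge0 // ltW.
have m0 : 0 < m by exact: lt_le_trans am.
have epsm : 2 * eps <= m.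
  by apply: le_trans am; rewrite /eps; move: a0; clear; lra.
have z0D : udisc z0.
  rewrite /udisc /= ltNge; apply/negP => z0ge.
  have z0B : sqnorm z0 = 1 by apply/eqP; rewrite eq_le z0ge andbT.
  have := am; rewrite /m /F (fbd _ z0B) z0B mulr0 add0r mulr1.
  rewrite ler_pdivlMr; last exact/w_gt/fdel'.
  have : a * (1 / 2) <= a * w (f z0) by rewrite ler_wpM2l ?w_ge ?fdel' // ltW.
  by rewrite /eps; move: a0 (a * w _); clear => ? b; lra.
pose p := f z0.
have num z : udisc_closed z -> sg * r (f z) + eps * sqnorm z <= m * w (f z).
  move=> zA; rewrite -ler_pdivrMr; last exact/w_gt/fdel'.
  by apply: zmax; rewrite inE.
have num0 : sg * r p + eps * sqnorm z0 = m * w p.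
  by rewrite /m /F divfK // gt_eqF // w_gt // fdel.
(* r' o f + h = sg phi + eps |z|^2 - m w, nonpositive with value 0 at z0. *)
pose r' q : R^o := sg * r q + (m * K * sqnorm q + - m).
pose h (z : Cn R 1) : R^o := eps * sqnorm z.
have oD := @open_udisc R.
have CJ1 := CkW CJ.
have Cs : Ck 2 Omega (@sqnorm R (n + n)) by exact: Ck_sqnorm.
have Cr' : Ck 2 Omega r'.
  have C1 : Ck 2 Omega (fun q => sg * r q : R^o).
    exact: CkM oO (Ck_cst Omega 2 (sg : R^o)) Cr.
  have C2 : Ck 2 Omega (fun q => m * K * sqnorm q : R^o).
    exact: CkM oO (Ck_cst Omega 2 (m * K : R^o)) Cs.
  exact: CkD oO C1 (CkD oO C2 (Ck_cst Omega 2 (- m : R^o))).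
have Ch : Ck 2 udisc h.
  exact: CkM oD (Ck_cst udisc 2 (eps : R^o)) (Ck_sqnorm 2 oD).
have fO : f @` udisc `<=` Omega.
  by move=> _ [z zD <-]; have [] := H _ (fd _ (sub _ zD)).
have Op : Omega p by apply: fO; exists z0.
have near_max : \forall x \near z0, r' (f x) + h x <= r' (f z0) + h z0.
  apply: filterS (open_nbhs_nbhs (conj oD z0D)) => x xD.
  have E q z : r' q + h z = sg * r q + eps * sqnorm z - m * w q.
    by rewrite /r' /h /w; ring.
  rewrite !E; apply: (@le_trans _ _ 0); first by rewrite subr_le0; exact/num/sub.
  by rewrite subr_ge0 -num0.
have LM := levi_max_principle oO CJ1 Cr' fO hol Ch z0D near_max.
have hE x v : 'd h x v = eps * 'd (@sqnorm R (1 + 1)) x v.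
  have [ds _] := @Ck_sqnorm R (1 + 1) 1 setT openT.
  exact: diffZ_at (ds _ I).
have hE2 v z : 'd (fun x => 'd h x v) z v =
    eps * 'd (fun x => 'd (@sqnorm R (1 + 1)) x v : R^o) z v.
  have hEv : (fun x => 'd h x v) = (fun x => eps * 'd (@sqnorm R (1 + 1)) x v : R^o).
    by apply/funext => x; exact: hE.
  apply: etrans (congr1 (fun k : Cn R 1 -> R^o => 'd k z v) hEv) _.
  have [_ /(_ v) [ds _]] := @Ck_sqnorm R (1 + 1) 2 setT openT.
  exact: diffZ_at (ds _ I).
have [lap1 lap2] := laplacian_sqnorm z0.
have [Jp_B [levi_r levi_s]] : `|J p| <= B /\
    (forall v, `|levi_form J r p v| <= C * (`|r p| * `|v| ^+ 2
      + `|v| * (`|'d r p v| + `|'d r p (v *m J p)|))) /\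
    (forall v, `|v| ^+ 2 <= levi_form J (@sqnorm R (n + n)) p v).
  by have [] := H _ (fd _ (sub _ z0D)).
have [[dr _] [ds _]] := (Cr, Cs).
pose fx := 'd f z0 (ex R); pose fy := 'd f z0 (ey R).
have fyE : fx *m J p = fy by rewrite /fy -ex_Jst (hol.2 _ _ z0D).
have [[dR' _] dR'E] := Ck1_comp oD fO hol.1 (CkW Cr').
have [dh _] := Ch.
have crit v : sg * 'd r p ('d f z0 v) = - (m * K * 'd (@sqnorm R _) p ('d f z0 v)
    + eps * 'd (@sqnorm R _) z0 v).
  have du0 : 'd (fun x => r' (f x) + h x) z0 v = 0.
    apply: diff_local_max near_max.
    exact: (differentiableD (dR' _ z0D) (dh _ z0D)).
  have duE := diffD_at v (dR' _ z0D) (dh _ z0D).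
  have r'E := diff_lincomb sg (m * K) (- m) ('d f z0 v) (dr _ Op) (ds _ Op).
  have alg (X Y Z U V W T : R) : U = 0 -> U = V + W -> V = T -> T = X + Y ->
    W = Z -> X = - (Y + Z) by clear; move=> *; lra.
  exact: alg du0 duE (dR'E _ _ z0D) r'E (hE _ _).
have p_del : `|p| <= del by exact: fdel.
have z0_1 : `|z0| <= 1.
  rewrite -(@ler_pXn2r _ 2) ?nnegrE // expr1n.
  exact: le_trans (sqr_norm_le _) (ltW z0D).
have sgn (x : R) : `|sg * x| = `|x| by rewrite normrM sg1 mul1r.
have mK0 : 0 <= m * K by rewrite mulr_ge0 // ltW.
have first_order v : `|v| <= 1 ->
    `|'d r p ('d f z0 v)| <= m * K * (2 * N * del * `|'d f z0 v|) + eps * 4.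
  move=> v1; rewrite -sgn crit normrN.
  apply: le_trans (ler_normD _ _) _; rewrite (normrM (m * K)) (normrM eps).
  rewrite (ger0_norm mK0) (gtr0_norm eps0).
  apply: lerD; apply: ler_wpM2l => //; [|exact: ltW|].
    apply: le_trans (norm_diff_sqnorm_le _ _) _; rewrite -/N.
    by apply: ler_wpM2r => //; apply: ler_wpM2l => //; exact: mulr_ge0.
  apply: le_trans (norm_diff_sqnorm_le _ _) _.
  rewrite [leRHS](_ : 4 = 2 * (1 + 1)%:R * 1 * 1); last by ring.
  by apply: ler_pM => //; apply: ler_wpM2l.
have al_le := first_order _ (norm_ex R); rewrite -/fx in al_le.
have be_le : `|'d r p (fx *m J p)| <=
    m * K * (2 * N * del * (N * `|fx| * B)) + eps * 4.
  rewrite fyE; apply: le_trans (first_order _ (norm_ey R)) _; rewrite lerD2r.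
  apply: ler_wpM2l => //; apply: ler_wpM2l; first by rewrite !mulr_ge0.
  rewrite -/fy -fyE; apply: le_trans (norm_mulmx_le _ _) _.
  by rewrite ler_wpM2l // mulr_ge0.
have rp_le : `|r p| <= m.
  rewrite -sgn.
  have sgE : sg * r p = m * w p - eps * sqnorm z0 by rewrite -num0 addrK.
  have mw0 : 0 <= m * w p by rewrite mulr_ge0 ?ltW // w_gt.
  have mwm : m * w p <= m by rewrite ler_piMr // ltW.
  have es0 : 0 <= eps * sqnorm z0 by rewrite mulr_ge0 // ltW.
  have es1 : eps * sqnorm z0 <= eps by rewrite ler_piMr // ltW.
  rewrite sgE ler_norml; move: mw0 mwm es0 es1 epsm eps0.
  by move: (m * w p) (eps * sqnorm z0); clear => y y'; lra.
have levi_le : - (C * (`|r p| * `|fx| ^+ 2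
    + `|fx| * (`|'d r p fx| + `|'d r p (fx *m J p)|))) <= sg * levi_form J r p fx.
  rewrite lerNl; apply: le_trans (ler_norm _) _.
  by rewrite normrN sgn; exact: levi_r.
apply: (levi_estimates_incompatible (erefl K) C0 (ltW m0) eps0 epsm (normr_ge0 fx)
  CKdel rp_le al_le be_le levi_le (levi_s fx) K0).
have L'E := levi_form_lincomb sg (m * K) (- m) fx oO Op CJ1 Cr Cs.
have alg (X Y Z X' Y' Z' : R) : X + (Y + Z) <= 0 -> X = X' -> Y = eps * Y' ->
    Z = eps * Z' -> Y' = 2 -> Z' = 2 -> X' + (eps * 2 + eps * 2) <= 0.
  by move=> LMh <- YE ZE Y2 Z2; move: LMh; rewrite YE ZE Y2 Z2.
exact: alg LM L'E (hE2 _ _) (hE2 _ _) lap1 lap2.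
Qed.

Theorem lemma3p3 (R : realType) (n : nat) (Omega : set (Cn R n))
    (J : Cn R n -> 'M[R]_(n + n)) (Gamma : set (Cn R n))
    (Omega_open : open Omega) (Omega0 : Omega 0)
    (J_ac : almost_complex Omega J) (J0 : J 0 = Jst)
    (Gamma_hyp : smooth_hypersurface Omega Gamma) (Gamma0 : Gamma 0)
    (Gamma_flat : levi_flat Omega J Gamma) :
  exists U0 : set (Cn R n),
    [/\ nbhs (0 : Cn R n) U0, U0 `<=` Omega &
      forall U : set (Cn R n), nbhs (0 : Cn R n) U -> U `<=` U0 ->
      forall f : Cn R 1 -> Cn R n,
        f @` udisc `<=` U -> bishop_disc J Gamma f ->
        f @` udisc_closed `<=` Gamma].
Proof.
have [CJ JJ] := J_ac; have [r [Cr GammaE dr] flat] := Gamma_flat.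
have GammaP p : Gamma p <-> Omega p /\ r p = 0 by rewrite GammaE.
have [_ r0] := (GammaP 0).1 Gamma0.
have flat' p v : Omega p -> r p = 0 -> complex_tangent_space J r p v ->
    levi_form J r p v = 0.
  by move=> Op rp; apply: flat; apply/GammaP.
have [C [d1 [C0 d10 H1]]] := levi_flat_bound Omega_open Omega0 (CJ 2%N) JJ (Cr 3%N)
  r0 (dr _ Gamma0) flat'.
have [B [d2 [B0 d20 H2]]] := levi_mx_bounded Omega_open Omega0 (CJ 2%N) (Cr 3%N).
have [d3 d30 H3] := levi_sqnorm_ge Omega_open Omega0 (CJ 2%N) (JJ _ Omega0).
pose d := Num.min (Num.min d1 d2) d3.
have d0 : 0 < d by rewrite !lt_min d10 d20.
have H p : `|p| < d -> [/\ Omega p, `|J p| <= B,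
     forall v, `|levi_form J r p v| <= C * (`|r p| * `|v| ^+ 2
      + `|v| * (`|'d (r : _ -> R^o) p v| + `|'d (r : _ -> R^o) p (v *m J p)|)) &
     forall v, `|v| ^+ 2 <= levi_form J (@sqnorm R (n + n)) p v].
  rewrite !lt_min => /andP[/andP[p1 p2] p3]; have [Op L1] := H1 _ p1.
  have [_ [Jp _ _] _] := H2 _ _ p2 p2.
  by split=> // v; exact: H3.
pose N : R := (n + n)%:R; pose K := C + 4 * C ^+ 2 + 1.
have N0 : 0 <= N by exact: ler0n.
have K0 : 0 <= K by rewrite addr_ge0 // addr_ge0 // mulr_ge0 // exprn_ge0.
(* Q collects the two smallness conditions on the radius. *)
pose Q := 2 * (K * N) + 2 * C * K * N * (1 + N * B) + 1.
have Q1 : 0 <= 2 * (K * N) by rewrite !mulr_ge0.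
have Q2 : 0 <= 2 * C * K * N * (1 + N * B) by rewrite !(mulr_ge0, addr_ge0).
have Q0 : 0 < Q by rewrite ltr_pwDr // addr_ge0.
pose del := Num.min (d / 2) Q^-1.
have del0 : 0 < del by rewrite lt_min divr_gt0 // invr_gt0.
have deld : del < d.
  by apply: (@le_lt_trans _ _ (d / 2)); [rewrite ge_min lexx | lra].
have delQ x : 0 <= x -> x <= Q -> x * del <= 1.
  move=> x0 xQ; apply: (@le_trans _ _ (Q * Q^-1)).
    by apply: ler_pM => //; [exact: ltW | rewrite ge_min lexx orbT].
  by rewrite divff // gt_eqF.
have small1 : K * (N * del ^+ 2) <= 1 / 2.
  have h1 : 2 * (K * N) * del <= 1 by apply: delQ => //; rewrite /Q; lra.
  have h2 : 1 * del <= 1 by apply: delQ => //; rewrite /Q; lra.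
  have h3 : 2 * (K * N) * del * del <= 1 * 1.
    by apply: ler_pM => //; [rewrite mulr_ge0 // ltW | exact: ltW | rewrite mul1r in h2].
  by lra.
have small2 : 2 * C * K * N * del * (1 + N * B) <= 1.
  rewrite (_ : _ * _ * (1 + _) = 2 * C * K * N * (1 + N * B) * del); last by ring.
  by apply: delQ => //; rewrite /Q; lra.
have del2 : 0 <= del < d by rewrite ltW.
exists [set p | `|p| < del]; split.
- exact: (@nbhs0_lt R (Cn R n) del del0).
- by move=> p /= pd; have [] := H p (lt_trans pd deld).
move=> U _ UU0 f fU [hol cf fbd].
have fdel z : udisc z -> `|f z| <= del.
  by move=> zD; apply/ltW/UU0/fU; exists z.
have fbd0 z : udisc_boundary z -> r (f z) = 0.
  by move=> zB; apply: (proj2 ((GammaP _).1 _)); apply: fbd; exists z.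
have sided sg : `|sg| = 1 -> forall z, udisc z -> sg * r (f z) <= 0.
  move=> sg1; exact: (bishop_disc_one_sided Omega_open (CJ 2%N) (Cr 2%N) B0 C0 H
    del2 small1 small2 sg1 hol cf fdel fbd0).
move=> _ [z zA <-].
have [zD|zD] := ltP (\sum_i z 0 i ^+ 2) 1.
  apply/GammaP; split.
    by have [] := H _ (le_lt_trans (fdel _ zD) deld).
  apply/eqP; rewrite eq_le.
  have := sided 1 (normr1 R) _ zD; rewrite mul1r => -> /=.
  by have := sided (-1) (normrN1 R) _ zD; rewrite mulN1r oppr_le0.
by apply: fbd; exists z => //; apply/eqP; rewrite eq_le zA zD.
Qed.
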